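(* Let $A\in M_{m\times n}(\mathbf R^+)$. Run the following light-and-shadows real RSK algorithm: set $P\leftarrow\emptyset$, $Q\leftarrow\emptyset$. While $A$ is non-zero: set $S\leftarrow 0_{m\times n}$, $p\leftarrow\emptyset$, $q\leftarrow\emptyset$; while $A$ is non-zero: compute $L(A)=(i_1,j_1),\dots,(i_r,j_r)$, let $\delta=\min\{a_{i_1j_1},\dots,a_{i_rj_r}\}$, set $a_{i_sj_s}\leftarrow a_{i_sj_s}-\delta$ for $s=1,\dots,r$, set $s_{i_{s+1}j_s}\leftarrow s_{i_{s+1}j_s}+\delta$ for $s=1,\dots,r-1$, and set $p\leftarrow p\,j_1^{\delta}$, $q\leftarrow q\,i_r^{\delta}$; after this inner loop set $P\leftarrow pP$, $Q\leftarrow qQ$, and $A\leftarrow S$. Return $(P,Q)$. Then the output equals $\mathrm{RSK}(A)=(P(u_A),P(v_A))$ for the original matrix $A$.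
   Context: $M_{m\times n}(\mathbf R^+)$ is the set of $m\times n$ matrices with non-negative real entries; $S=(s_{ij})$. Let $P_{mn}=\{(i,j):1\le i\le m,1\le j\le n\}$ with the partial order $(i,j)\le(i',j')$ iff $i\le i'$ and $j\le j'$. For $A$, $\mathrm{supp}(A)=\{(i,j):a_{ij}>0\}$, and the sequence of leading points $L(A)$ is the set of maximal elements of $\mathrm{supp}(A)$ listed as $(i_1,j_1),\dots,(i_r,j_r)$ with $j_1<\dots<j_r$ (hence $i_1>\dots>i_r$). For $N\ge1$ let $A_N=\{1,\dots,N\}$. A timed word of length $r\ge0$ in $A_N$ is a right-continuous piecewise-constant function $w:[0,r)\to A_N$ with finitely many discontinuities; $l(w)=r$. We write $w=c_1^{t_1}\cdots c_k^{t_k}$ ($t_i\ge0$, zero exponents omitted) if $w$ takes value $c_i$ on $[t_1+\dots+t_{i-1},t_1+\dots+t_i)$; adjacent equal letters merge. Concatenation is the product; $\emptyset$ is the empty word. $w_{[a,b)}(t)=w(a+t)$. A timed row is a weakly increasing timed word. Every timed word has a unique row decomposition $w=u_l\cdots u_1$ into timed rows with $u_iu_{i-1}$ never a row. Row insertion: for a timed row $u$, letter $c$, $t_c\ge0$: if $u(t)\le c$ for all $t$, $\mathrm{RINS}(u,c^{t_c})=(\emptyset,uc^{t_c})$; otherwise with $t_0=\min\{t:u(t)>c\}$, $\mathrm{RINS}(u,c^{t_c})=(u_{[t_0,t_0+t_c)},u_{[0,t_0)}c^{t_c}u_{[t_0+t_c,l(u))})$ if $l(u)-t_0>t_c$, else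 $(u_{[t_0,l(u))},u_{[0,t_0)}c^{t_c})$. For a row $v=c_1^{t_1}\cdots c_k^{t_k}$: if $(v',u')=\mathrm{RINS}(u,c_1^{t_1}\cdots c_{k-1}^{t_{k-1}})$ and $(v'',u'')=\mathrm{RINS}(u',c_k^{t_k})$ then $\mathrm{RINS}(u,v)=(v'v'',u'')$. For a timed word $w$ whose row decomposition $u_l\cdots u_1$ satisfies $u_1\lhd\cdots\lhd u_l$ (a timed tableau; $u\lhd v$ means $l(u)\ge l(v)$ and $u(t)<v(t)$ for $0\le t<l(v)$) and a row $v$: $v_0'=v$, $(v_i',u_i')=\mathrm{RINS}(u_i,v_{i-1}')$, $\mathrm{INSERT}(w,v)=v_l'u_l'\cdots u_1'$. If $w=u_1\cdots u_l$ is the row decomposition (left to right), $P(w)=\mathrm{INSERT}(\cdots\mathrm{INSERT}(u_1,u_2)\cdots,u_l)$. For $A=(a_{ij})$: $u_A=1^{a_{11}}\cdots n^{a_{1n}}\,1^{a_{21}}\cdots n^{a_{2n}}\cdots1^{a_{m1}}\cdots n^{a_{mn}}$ and $v_A=1^{a_{11}}\cdots m^{a_{m1}}\,1^{a_{12}}\cdots m^{a_{m2}}\cdots1^{a_{1n}}\cdots m^{a_{mn}}$.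
   Formalization: The algorithm as printed fails (e.g. for the 2×2 matrix with a_12=a_21=1, others 0); here L(A) consists of the minimal, not maximal, elements of supp(A), and the shadow update is s_{i_s j_{s+1}} += δ instead of s_{i_{s+1} j_s} += δ. *)

(* Defs.v *)
From HB Require Import structures.
From mathcomp Require Import all_boot all_order all_algebra.
From mathcomp Require Import boolp classical_sets reals.
Set Implicit Arguments.
Unset Strict Implicit.
Unset Printing Implicit Defensive.
Import Order.TTheory GRing.Theory Num.Theory.
Local Open Scope classical_set_scope.
Local Open Scope ring_scope.

(** * Timed words

    The alphabet {1, ..., N} is ['I_N] with its usual order, and rows and
    columns of matrices are indexed by ['I_m] and ['I_n]: every index and
    letter is shifted down by one.

    A timed word is a partial function on the reals, [Some] exactly on
    [0, tlen); with proof irrelevance and functional extensionality, equality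
    of timed words is equality of the underlying functions on [0, tlen).
    [tval_pw] says that the word is constant on every interval avoiding a
    finite set of points. *)

Record timed_word (R : realType) (N : nat) := TimedWord {
  tlen : R;
  tval :> R -> option 'I_N;
  tlen_ge0 : 0 <= tlen;
  tval_dom : forall t, isSome (tval t) = (0 <= t < tlen);
  tval_rcont : forall t, 0 <= t < tlen ->
    exists2 e : R, 0 < e &
      forall s, t <= s < t + e -> s < tlen -> tval s = tval t;
  tval_pw : exists D : seq R, forall x y, 0 <= x -> x <= y -> y < tlen ->
    (forall z, z \in D -> ~~ (x <= z <= y)) -> tval x = tval y }.

HB.instance Definition _ (R : realType) (N : nat) :=
  gen_eqMixin (timed_word R N).
HB.instance Definition _ (R : realType) (N : nat) :=
  gen_choiceMixin (timed_word R N).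

Section TimedWordOperations.
Variables (R : realType) (N : nat).
Local Notation word := (timed_word R N).
Implicit Types (u v w : word) (c : 'I_N).

(** ** The word [c^t]; a negative exponent is read as 0 *)

Definition tpow_val c (t : R) (x : R) : option 'I_N :=
  if 0 <= x < Num.max 0 t then Some c else None.

Fact tpow_ge0 (t : R) : 0 <= Num.max 0 t.
Proof. by rewrite le_max lexx. Qed.

Fact tpow_dom c (t x : R) : isSome (tpow_val c t x) = (0 <= x < Num.max 0 t).
Proof. by rewrite /tpow_val; case: ifP. Qed.

Fact tpow_rcont c (t x : R) : 0 <= x < Num.max 0 t ->
  exists2 e : R, 0 < e & forall s, x <= s < x + e -> s < Num.max 0 t ->
    tpow_val c t s = tpow_val c t x.
Proof.
move=> xP; exists 1 => // s /andP[xs _] sl; rewrite /tpow_val xP sl.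
by case/andP: xP => x0 _; rewrite (le_trans x0 xs).
Qed.

Fact tpow_pw c (t : R) : exists D : seq R, forall x y,
  0 <= x -> x <= y -> y < Num.max 0 t ->
  (forall z, z \in D -> ~~ (x <= z <= y)) -> tpow_val c t x = tpow_val c t y.
Proof.
exists [::] => x y x0 xy yl _; rewrite /tpow_val x0 yl (le_trans x0 xy).
by rewrite (le_lt_trans xy yl).
Qed.

Definition tpow c (t : R) : word :=
  TimedWord (tpow_ge0 t) (tpow_dom c t) (@tpow_rcont c t) (tpow_pw c t).

(** ** The empty word *)

Fact tempty_dom (t : R) : isSome (@None 'I_N) = (0 <= t < 0).
Proof. by apply/esym/negbTE/negP => /andP[/le_lt_trans h /h]; rewrite ltxx. Qed.

Fact tempty_rcont (t : R) : 0 <= t < 0 ->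
  exists2 e : R, 0 < e & forall s, t <= s < t + e -> s < 0 ->
    @None 'I_N = None.
Proof. by exists 1. Qed.

Fact tempty_pw : exists D : seq R, forall x y : R,
  0 <= x -> x <= y -> y < 0 ->
  (forall z, z \in D -> ~~ (x <= z <= y)) -> @None 'I_N = None.
Proof. by exists [::]. Qed.

Definition tempty : word :=
  TimedWord (lexx 0) tempty_dom tempty_rcont tempty_pw.

(** ** Concatenation *)

Definition tcat_val u v (t : R) : option 'I_N :=
  if t < tlen u then u t else v (t - tlen u).

Fact tcat_ge0 u v : 0 <= tlen u + tlen v.
Proof. by rewrite addr_ge0 ?tlen_ge0. Qed.

Fact tcat_dom u v (t : R) :
  isSome (tcat_val u v t) = (0 <= t < tlen u + tlen v).
Proof.
rewrite /tcat_val; case: ltP => h; rewrite tval_dom.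
  rewrite h andbT; case: (0 <= t) => //=.
  by rewrite (lt_le_trans h) // lerDl tlen_ge0.
by rewrite subr_ge0 h ltrBlDl (le_trans (tlen_ge0 u) h).
Qed.

Fact tcat_rcont u v (t : R) : 0 <= t < tlen u + tlen v ->
  exists2 e : R, 0 < e & forall s, t <= s < t + e -> s < tlen u + tlen v ->
    tcat_val u v s = tcat_val u v t.
Proof.
move=> /andP[t0 tl]; rewrite /tcat_val; case: (ltP t (tlen u)) => h.
  have [|e e0 He] := @tval_rcont _ _ u t; first by rewrite t0.
  exists (Num.min e (tlen u - t)); first by rewrite lt_min e0 subr_gt0.
  move=> s /andP[ts]; rewrite -ltrBlDl lt_min => /andP[s1 s2] _.
  have su : s < tlen u by rewrite ltrD2r in s2.
  by rewrite su He // ts -ltrBlDl.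
have [|e e0 He] := @tval_rcont _ _ v (t - tlen u).
  by rewrite subr_ge0 h ltrBlDl.
exists e => // s /andP[ts se] sl.
rewrite ltNge (le_trans h ts) /= He // ?ltrBlDl //.
by rewrite lerD2r ts /= addrA [tlen u + _]addrC subrK.
Qed.

Fact tcat_pw u v : exists D : seq R, forall x y,
  0 <= x -> x <= y -> y < tlen u + tlen v ->
  (forall z, z \in D -> ~~ (x <= z <= y)) -> tcat_val u v x = tcat_val u v y.
Proof.
have [D1 H1] := tval_pw u; have [D2 H2] := tval_pw v.
exists (tlen u :: D1 ++ [seq z + tlen u | z <- D2]) => x y x0 xy yl H.
have := H (tlen u); rewrite inE eqxx => /(_ isT).
rewrite /tcat_val negb_and -!ltNge => /orP[ux|yu]; last first.
  rewrite yu (le_lt_trans xy yu); apply: H1 => // z zD.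
  by apply: H; rewrite inE mem_cat zD orbT.
rewrite !ltNge (ltW ux) (le_trans (ltW ux) xy) /=.
apply: H2; rewrite ?subr_ge0 ?(ltW ux) ?lerD2r ?ltrBlDl // => z zD.
rewrite lerBlDr lerBrDr; apply: H.
by rewrite inE mem_cat (map_f (fun z => z + tlen u) zD) !orbT.
Qed.

Definition tcat u v : word :=
  TimedWord (tcat_ge0 u v) (tcat_dom u v) (@tcat_rcont u v) (tcat_pw u v).

(** ** The segment [w_[a, b)]; the bounds are clamped to [0, tlen w], and the
    segment is empty if [b <= a] *)

Definition tsub_start (a : R) : R := Num.max 0 a.
Definition tsub_len w (a b : R) : R :=
  Num.max 0 (Num.min b (tlen w) - tsub_start a).
Definition tsub_val w (a b t : R) : option 'I_N :=
  if 0 <= t < tsub_len w a b then w (tsub_start a + t) else None.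

Fact tsub_in w (a b t : R) : 0 <= t < tsub_len w a b ->
  0 <= tsub_start a + t < tlen w.
Proof.
move=> /andP[t0]; rewrite /tsub_len lt_max ltNge t0 /= ltrBrDl lt_min.
by move=> /andP[_ ->]; rewrite addr_ge0 // /tsub_start le_max lexx.
Qed.

Fact tsub_ge0 w (a b : R) : 0 <= tsub_len w a b.
Proof. by rewrite le_max lexx. Qed.

Fact tsub_dom w (a b t : R) :
  isSome (tsub_val w a b t) = (0 <= t < tsub_len w a b).
Proof.
by rewrite /tsub_val; case: ifP => // /tsub_in h; rewrite tval_dom.
Qed.

Fact tsub_rcont w (a b t : R) : 0 <= t < tsub_len w a b ->
  exists2 e : R, 0 < e & forall s, t <= s < t + e -> s < tsub_len w a b ->
    tsub_val w a b s = tsub_val w a b t.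
Proof.
move=> tP; have [e e0 He] := tval_rcont (tsub_in tP).
exists e => // s /andP[ts se] sl.
have sP : 0 <= s < tsub_len w a b.
  by case/andP: tP => t0 _; rewrite (le_trans t0 ts).
rewrite /tsub_val sP tP; apply: He; last by case/andP: (tsub_in sP).
by rewrite lerD2l ts /= -addrA ltrD2l.
Qed.

Fact tsub_pw w (a b : R) : exists D : seq R, forall x y,
  0 <= x -> x <= y -> y < tsub_len w a b ->
  (forall z, z \in D -> ~~ (x <= z <= y)) -> tsub_val w a b x = tsub_val w a b y.
Proof.
have [D HD] := tval_pw w.
exists [seq z - tsub_start a | z <- D] => x y x0 xy yl H.
have yP : 0 <= y < tsub_len w a b by rewrite (le_trans x0 xy).
have xP : 0 <= x < tsub_len w a b by rewrite x0 (le_lt_trans xy yl).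
rewrite /tsub_val xP yP.
have /andP[x1 _] := tsub_in xP; have /andP[_ y1] := tsub_in yP.
apply: HD => //; first by rewrite lerD2l.
move=> z zD.
have -> : (tsub_start a + x <= z <= tsub_start a + y)
    = (x <= z - tsub_start a <= y) by rewrite lerBrDl lerBlDl.
apply: H; exact: (map_f (fun z => z - tsub_start a) zD).
Qed.

Definition tsub w (a b : R) : word :=
  TimedWord (tsub_ge0 w a b) (tsub_dom w a b) (@tsub_rcont w a b)
            (tsub_pw w a b).

(** ** Reduced expressions and row decompositions

    Both exist and are unique, so the choices made by [xget] are harmless. *)

Definition is_reduced_expr w (s : seq ('I_N * R)) : Prop :=
  [/\ all (fun x => 0 < x.2) s, sorted (fun x y => x.1 != y.1) s
    & w = \big[tcat/tempty]_(x <- s) tpow x.1 x.2].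

Definition reduced_expr w : seq ('I_N * R) := xget [::] (is_reduced_expr w).

Definition is_row w : Prop :=
  forall (s t : R) c d, s <= t -> w s = Some c -> w t = Some d -> (c <= d)%N.

(** The rows are required to be non-empty so that the empty word decomposes
    only as the empty product; for other words this is automatic. *)
Definition is_row_decomposition w (us : seq word) : Prop :=
  [/\ w = \big[tcat/tempty]_(u <- us) u,
      all (fun u => (u != tempty) && `[< is_row u >]) us
    & sorted (fun u v => ~~ `[< is_row (tcat u v) >]) us].

Definition row_decomposition w : seq word :=
  xget [::] (is_row_decomposition w).

(** ** Row insertion, tableau insertion and the P-tableau

    The functions below are total; the side conditions (rows, tableaux) under
    which they are meaningful hold wherever [tableauP] uses them. *)

Definition exceeds u c : set R := [set t | exists2 d, u t = Some d & (c < d)%N].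

(** min {t : u(t) > c}; the minimum is attained by right-continuity. *)
Definition first_exceed u c : R :=
  xget 0 [set t | exceeds u c t /\ lbound (exceeds u c) t].

Definition rins1 u c (tc : R) : word * word :=
  if `[< forall t d, u t = Some d -> (d <= c)%N >] then
    (tempty, tcat u (tpow c tc))
  else
    let t0 := first_exceed u c in
    if tc < tlen u - t0 then
      (tsub u t0 (t0 + tc),
       tcat (tcat (tsub u 0 t0) (tpow c tc)) (tsub u (t0 + tc) (tlen u)))
    else
      (tsub u t0 (tlen u), tcat (tsub u 0 t0) (tpow c tc)).

Definition rins u v : word * word :=
  foldl (fun acc x => let: (v', u') := acc in
                      let: (v'', u'') := rins1 u' x.1 x.2 in
                      (tcat v' v'', u''))
        (tempty, u) (reduced_expr v).

(** [insert_rows [:: u_1; ...; u_l] v = v_l' u_l' ... u_1'] *)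
Fixpoint insert_rows (us : seq word) v : word :=
  if us is u :: us' then
    let: (v', u') := rins u v in tcat (insert_rows us' v') u'
  else v.

(** The row decomposition of a tableau is written u_l ... u_1, and insertion
    starts with its last row u_1, whence the reversal. *)
Definition insert w v : word := insert_rows (rev (row_decomposition w)) v.

Definition tableauP w : word :=
  if row_decomposition w is u :: us then foldl insert u us else tempty.

End TimedWordOperations.

Arguments tempty {R N}.

(** * Real RSK *)

Section RSK.
Variables (R : realType) (m n : nat).
Implicit Types (A : 'M[R]_(m, n)).

Definition uword A : timed_word R n :=
  \big[@tcat R n/tempty]_(i < m) \big[@tcat R n/tempty]_(j < n) tpow j (A i j).

Definition vword A : timed_word R m :=
  \big[@tcat R m/tempty]_(j < n) \big[@tcat R m/tempty]_(i < m) tpow i (A i j).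

Definition RSK A : timed_word R n * timed_word R m :=
  (tableauP (uword A), tableauP (vword A)).

(** * The light-and-shadows algorithm

    Viennot's convention: the leading points are the minimal elements of the
    support for the componentwise order (the light comes from the corner
    (1, 1)).  Listed as (i_1, j_1), ..., (i_r, j_r) with j_1 < ... < j_r and
    i_1 > ... > i_r, the shadows of two consecutive ones meet at (i_s, j_{s+1}).

    This corrects the version of the algorithm with maximal elements and
    corners (i_{s+1}, j_s), which does not compute RSK: a round outputs the
    letters j_1 and i_r, so to preserve the content its shadow points must
    carry the columns j_2, ..., j_r and the rows i_1, ..., i_{r-1}.  On the
    2 x 2 antidiagonal permutation matrix that version returns P = 1^2, whereas
    P(u_A) = 2^1 1^1. *)

Definition support A : {set 'I_m * 'I_n} := [set x | 0 < A x.1 x.2]%SET.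

Definition point_le (x y : 'I_m * 'I_n) : bool :=
  (x.1 <= y.1)%N && (x.2 <= y.2)%N.

Definition leading_set A : {set 'I_m * 'I_n} :=
  [set x in support A | [forall y in support A, point_le y x ==> (y == x)]]%SET.

Definition leading_points A : seq ('I_m * 'I_n) :=
  sort (fun x y : 'I_m * 'I_n => (x.2 <= y.2)%N) (enum (leading_set A)).

Definition shadow_points (L : seq ('I_m * 'I_n)) : seq ('I_m * 'I_n) :=
  [seq (xy.1.1, xy.2.2) | xy <- zip L (behead L)].

(** State (A, S, p, q) of the inner loop ([S] is a constructor of [nat], hence [B]); the list of leading points is never
    empty when the loop guard holds of a non-negative matrix. *)
Definition inner_state : Type :=
  'M[R]_(m, n) * 'M[R]_(m, n) * timed_word R n * timed_word R m.

Definition inner_body (st : inner_state) : inner_state :=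
  let: (A, B, p, q) := st in
  if leading_points A is x :: L then
    let d := \big[Num.min/A x.1 x.2]_(y <- L) A y.1 y.2 in
    (A - \sum_(y <- x :: L) d *: delta_mx y.1 y.2,
     B + \sum_(y <- shadow_points (x :: L)) d *: delta_mx y.1 y.2,
     tcat p (tpow x.2 d),
     tcat q (tpow (last x L).1 d))
  else st.

End RSK.

(** [while_loop guard body s s']: the loop started in [s] terminates in [s']. *)
Inductive while_loop (T : Type) (guard : T -> bool) (body : T -> T -> Prop) :
    T -> T -> Prop :=
| While_stop s : ~~ guard s -> while_loop guard body s s
| While_step s s' s'' : guard s -> body s s' ->
    while_loop guard body s' s'' -> while_loop guard body s s''.

Section LightAndShadows.
Variables (R : realType) (m n : nat).

Definition inner_loop : inner_state R m n -> inner_state R m n -> Prop :=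
  while_loop (fun st => let: (A, _, _, _) := st in A != 0)
             (fun st st' => st' = inner_body st).

(** State (A, P, Q) of the outer loop. *)
Definition outer_state : Type :=
  'M[R]_(m, n) * timed_word R n * timed_word R m.

Definition outer_body (st st' : outer_state) : Prop :=
  let: (A, P, Q) := st in
  exists A' B p q, inner_loop (A, 0, tempty, tempty) (A', B, p, q) /\
                  st' = (B, tcat p P, tcat q Q).

Definition outer_loop : outer_state -> outer_state -> Prop :=
  while_loop (fun st => let: (A, _, _) := st in A != 0) outer_body.

Definition light_and_shadows (A : 'M[R]_(m, n))
    (PQ : timed_word R n * timed_word R m) : Prop :=
  exists A', outer_loop (A, tempty, tempty) (A', PQ.1, PQ.2).

End LightAndShadows.

(* Main.v *)
Require Import Defs.
From HB Require Import structures.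
From mathcomp Require Import all_boot all_order all_algebra.
From mathcomp Require Import reals.
From mathcomp Require Import boolp classical_sets.
From mathcomp Require Import zify lra.
Set Implicit Arguments.
Unset Strict Implicit.
Unset Printing Implicit Defensive.
Import Order.TTheory GRing.Theory Num.Theory.
Local Open Scope ring_scope.

(** Insert the rows of [A] one after the other into a single timed row.  If the
    leading points of [A] are thinned by [d], the row present at every stage
    loses exactly an initial segment [c^d], where [c] is the column of the
    leftmost leading point among the rows inserted so far: inserting the row of
    a leading point bumps this segment as a whole, and inserting any other row
    leaves it alone.  The bumped segments are the shadow points.  Hence one run
    of the inner loop computes the first row [p] of the tableau and, as the rows
    of the shadow matrix, the words bumped out of that row, so that the outer
    loop unrolls the cascade of row insertions defining [P(u_A)].  Transposition
    maps runs of the algorithm to runs, exchanging [p] and [q], which reduces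
    the claim on [P(v_A)] to the one on [P(u_A)]. *)

(* The segment contributed by a round is a prefix of the first row, so a run of the inner loop is
   read from its end: [first_row] passes from the thinned matrix back to the matrix before the round
   by prepending [c^d]. This rests on [d] being at most the entries at the leading points; that [d]
   equals one of them gives termination. For the enlarged word to be a row, [c] must be a lower
   bound of its letters. Hence the invariant traces every letter of the intermediate rows back to a
   positive entry in an earlier row of the matrix, because such an entry dominates a leading point.
   The same information about [S] makes the outer loop terminate. On the side of words, the obstacle
   is that insertion and [tableauP] go through a reduced expression and a row decomposition chosen
   by [xget], whereas a matrix delivers zero exponents, empty rows and rows that continue one
   another. Insertion is therefore first shown to depend neither on the expression nor on the way
   the word is cut into rows. *)
Local Infix ":+:" := tcat (at level 45, left associativity).

(** * Timed words *)

Section Words.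
Variables (R : realType) (N : nat).
Local Notation word := (timed_word R N).
Implicit Types (u v w x y z : word) (c d : 'I_N) (s t : R).

(** The values determine the length, since a word is defined exactly on [0, tlen); the remaining
    fields are propositions. *)
Lemma word_eq u v : (forall t, u t = v t) -> u = v.
Proof.
move=> uv; have tl (x y : word) : (forall t, x t = y t) -> tlen x <= tlen y.
  move=> xy; rewrite leNgt; apply/negP => yx.
  have := tval_dom y (tlen y); rewrite -xy tval_dom yx tlen_ge0 ltxx.
  by rewrite andbF.
have luv : tlen u = tlen v by apply/le_anti/andP; split; apply: tl.
case: u v uv luv {tl} => [lu fu u1 u2 u3 u4] [lv fv v1 v2 v3 v4] /= /funext E1 E2.
by subst fv lv; congr TimedWord; apply: Prop_irrelevance.
Qed.

Lemma tcatA : associative (@tcat R N).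
Proof.
move=> u v w; apply: word_eq => t /=; rewrite /tcat_val /= /tcat_val.
have [h|h] := ltP t (tlen u).
  by rewrite (lt_le_trans h) // lerDl tlen_ge0.
by rewrite ltrBlDl opprD addrA.
Qed.

Lemma tcat0w : left_id tempty (@tcat R N).
Proof.
move=> u; apply: word_eq => t /=; rewrite /tcat_val /= subr0.
case: ltP => // t0; apply/esym; have := tval_dom u t.
by rewrite leNgt t0; case: (u t).
Qed.

Lemma tcatw0 : right_id tempty (@tcat R N).
Proof.
move=> u; apply: word_eq => t /=; rewrite /tcat_val /=.
case: ltP => // t0; have := tval_dom u t.
by rewrite (ltNge t) t0 andbF; case: (u t).
Qed.

HB.instance Definition _ := Monoid.isLaw.Build word tempty (@tcat R N)
  tcatA tcat0w tcatw0.

Definition letter c w := exists t, w t = Some c.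

Lemma tval_letter u t : 0 <= t < tlen u -> exists2 c, u t = Some c & letter c u.
Proof.
by rewrite -tval_dom; case E: (u t) => [c|] // _; exists c => //; exists t.
Qed.

Lemma val_in u t c : u t = Some c -> 0 <= t < tlen u.
Proof. by rewrite -tval_dom => ->. Qed.

Lemma tlen0_tempty u : tlen u = 0 -> u = tempty.
Proof.
move=> u0; apply: word_eq => t; have := tval_dom u t.
by rewrite u0 -(tempty_dom N); case: (u t).
Qed.

Lemma tlen_gt0 u : u != tempty -> 0 < tlen u.
Proof.
move=> u0; rewrite lt_neqAle tlen_ge0 andbT; apply: contra u0 => /eqP u0.
by apply/eqP/tlen0_tempty.
Qed.

Lemma no_letter_tempty u : (forall c, ~ letter c u) -> u = tempty.
Proof.
move=> h; apply: word_eq => t /=; case E: (u t) => [c|] //.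
by case: (h c); exists t.
Qed.

Lemma letter_neq0 c u : letter c u -> u != tempty.
Proof. by case=> t ut; apply/eqP => u0; rewrite u0 in ut. Qed.

Lemma neq0_letter u : u != tempty -> exists c, letter c u.
Proof.
move=> /tlen_gt0 u0; have [|c _ ?] := @tval_letter u 0; last by exists c.
by rewrite lexx.
Qed.

Lemma letter_tempty c : ~ letter c tempty.
Proof. by case. Qed.

Lemma tcat_vall u v t : t < tlen u -> (u :+: v) t = u t.
Proof. by rewrite /= /tcat_val => ->. Qed.

Lemma tcat_valr u v t : 0 <= t -> (u :+: v) (tlen u + t) = v t.
Proof. by move=> t0; rewrite /= /tcat_val ltNge lerDl t0 /= addrAC subrr add0r. Qed.

Lemma letter_tcat c u v : letter c (u :+: v) <-> letter c u \/ letter c v.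
Proof.
split=> [[t]|[[t ut]|[t vt]]].
- rewrite /= /tcat_val; case: ifP => _ h; first by left; exists t.
  by right; exists (t - tlen u).
- by exists t; rewrite tcat_vall //; case/andP: (val_in ut).
- by exists (tlen u + t); rewrite tcat_valr //; case/andP: (val_in vt).
Qed.

Lemma letter_tpow c d t : letter c (tpow d t) <-> c = d /\ 0 < t.
Proof.
split=> [[x]|[-> t0]].
  rewrite /= /tpow_val; case: ifP => // /andP[x0 xt] [->]; split=> //.
  by move: (le_lt_trans x0 xt); rewrite lt_max ltxx.
by exists 0; rewrite /= /tpow_val lexx lt_max t0 orbT.
Qed.

Lemma tlen_tpow c t : 0 <= t -> tlen (tpow c t) = t.
Proof. by move=> t0; apply/max_idPr. Qed.

Lemma tpow0 c t : t <= 0 -> tpow c t = tempty.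
Proof.
by move=> t0; apply: no_letter_tempty => d /letter_tpow[_]; rewrite ltNge t0.
Qed.

Lemma tpow_neq0 c t : 0 < t -> tpow c t != tempty.
Proof. by move=> t0; apply: (@letter_neq0 c); apply/letter_tpow. Qed.

Lemma tpowD c s t : 0 <= s -> 0 <= t ->
  tpow c s :+: tpow c t = tpow c (s + t).
Proof.
move=> s0 t0; apply: word_eq => x; rewrite /= /tcat_val /= /tpow_val.
rewrite (max_idPr s0) (max_idPr t0) (max_idPr (addr_ge0 s0 t0)) subr_ge0 ltrBlDl.
case: (ltP x s) => // xs.
  by have -> : x < s + t; [rewrite (lt_le_trans xs) ?lerDl|].
by rewrite (le_trans s0 xs).
Qed.

Lemma tcat_eq0 u v : u :+: v = tempty -> u = tempty /\ v = tempty.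
Proof.
move=> h; split; apply: no_letter_tempty => c uc; apply: (@letter_tempty c).
  by rewrite -h letter_tcat; left.
by rewrite -h letter_tcat; right.
Qed.

Lemma tcat_inj u v v' : u :+: v = u :+: v' -> v = v'.
Proof.
move=> h; apply: word_eq => t; have [t0|t0] := leP 0 t.
  by rewrite -(tcat_valr u v t0) h tcat_valr.
have none (x : word) : x t = None.
  by have := tval_dom x t; rewrite leNgt t0; case: (x t).
by rewrite !none.
Qed.

(** With [x] or [z] empty where needed, this computes every segment that occurs in [rins1]. *)
Lemma tsub_mid x y z :
  tsub (x :+: y :+: z) (tlen x) (tlen x + tlen y) = y.
Proof.
have x0 := tlen_ge0 x; have y0 := tlen_ge0 y; have z0 := tlen_ge0 z.
apply: word_eq => t /=; rewrite /tsub_val /tsub_len /tsub_start /=.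
rewrite (max_idPr x0) (min_idPl _) ?lerDl // addrAC subrr add0r (max_idPr y0).
case: ifPn => ty; last first.
  by move: ty; rewrite -tval_dom; case: (y t).
have [t0 ty'] := andP ty.
rewrite /tcat_val /= ltrD2l ty' /tcat_val ltNge lerDl t0 /=.
by rewrite addrAC subrr add0r.
Qed.

Lemma tcat_tsub w t : 0 <= t <= tlen w ->
  w = tsub w 0 t :+: tsub w t (tlen w) /\ tlen (tsub w 0 t) = t.
Proof.
move=> /andP[t0 tw]; have E : tlen (tsub w 0 t) = t.
  by rewrite /= /tsub_len /tsub_start maxxx subr0 (min_idPl tw); apply/max_idPr.
split=> //; apply: word_eq => x; rewrite /= /tcat_val E /=.
rewrite /tsub_val /tsub_len /tsub_start maxxx subr0 minxx (min_idPl tw).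
have wt : 0 <= tlen w - t by rewrite subr_ge0.
rewrite (max_idPr t0) (max_idPr wt) add0r.
case: ltP => [xt|tx].
  rewrite andbT; case: ifPn => // x0.
  by have := tval_dom w x; rewrite (negPf x0); case: (w x).
rewrite subr_ge0 ltrD2r addrC subrK.
have := tval_dom w x; rewrite (le_trans t0 tx) tx /=.
by case: ifP; case: (w x).
Qed.

Lemma is_row_tcat u v : is_row (u :+: v) <->
  [/\ is_row u, is_row v
    & forall c d, letter c u -> letter d v -> (c <= d)%N].
Proof.
split=> [h|[hu hv huv]].
  split.
  - move=> s t c d st us ut; apply: (h s t) => //; rewrite tcat_vall //.
      by case/andP: (val_in us).
    by case/andP: (val_in ut).
  - move=> s t c d st us ut.
    apply: (h (tlen u + s) (tlen u + t)); rewrite ?lerD2l // tcat_valr //.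
      by case/andP: (val_in us).
    by case/andP: (val_in ut).
  - move=> c d [s us] [t vt]; apply: (h s (tlen u + t)).
    + have /andP[_ s1] := val_in us; have /andP[t0 _] := val_in vt.
      by rewrite (le_trans (ltW s1)) // lerDl.
    + by rewrite tcat_vall //; case/andP: (val_in us).
    + by rewrite tcat_valr //; case/andP: (val_in vt).
move=> s t c d st; rewrite /= /tcat_val; case: ltP => su; case: ltP => tu.
- exact: hu.
- by move=> us vt; apply: huv; [exists s|exists (t - tlen u)].
- by have := lt_le_trans tu (le_trans su st); rewrite ltxx.
- by apply: hv; rewrite lerD2r.
Qed.

Lemma is_row_tempty : is_row (@tempty R N).
Proof. by []. Qed.

Lemma is_row_tpow c t : is_row (tpow c t).
Proof.
move=> x y d e _ hx hy; have [] := (letter_tpow d c t).1; first by exists x.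
by have [] := (letter_tpow e c t).1; [exists y|move=> -> _ ->].
Qed.

Lemma is_rowl u v : is_row (u :+: v) -> is_row u.
Proof. by case/is_row_tcat. Qed.

Lemma is_rowr u v : is_row (u :+: v) -> is_row v.
Proof. by case/is_row_tcat. Qed.

(* The cut is at the supremum of the times at which the value is at most [k];
   right-continuity gives the strict inequality at the cut itself. *)
Lemma row_split (k : nat) u : is_row u -> exists a b,
  [/\ u = a :+: b, forall c, letter c a -> (c <= k)%N
    & forall c, letter c b -> (k < c)%N].
Proof.
move=> ru.
(* The point 0 is put into [E] so that the supremum exists even if no letter is at most [k]. *)
pose E : set R := [set t | t = 0 \/ exists2 c, u t = Some c & (c <= k)%N]%classic.
have hE : has_sup E.
  split; first by exists 0; left.
  exists (tlen u) => t [->|[c ut _]]; first exact: tlen_ge0.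
  by have /andP[_ /ltW] := val_in ut.
have sup0 : 0 <= sup E by apply: sup_upper_bound => //; left.
have supl : sup E <= tlen u.
  apply: ge_sup; first by exists 0; left.
  move=> t [->|[c ut _]]; first exact: tlen_ge0.
  by have /andP[_ /ltW] := val_in ut.
have [|E1 E2] := @tcat_tsub u (sup E); first by rewrite sup0.
exists (tsub u 0 (sup E)), (tsub u (sup E) (tlen u)); split=> // c [t].
  rewrite /= /tsub_val; case: ifP => // /andP[t0 tl].
  rewrite /tsub_start maxxx add0r => ut.
  have tE : t < sup E by rewrite -E2.
  have [|y [y0|[d uy dk]] ty] := @sup_gt _ E t _ tE.
  - by exists 0; left.
  - by move: (le_lt_trans t0 ty); rewrite y0 ltxx.
  - by apply: leq_trans dk; apply: (ru t y) => //; apply: ltW.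
rewrite /= /tsub_val /tsub_len /tsub_start (max_idPr sup0) minxx.
case: ifP => // /andP[t0 _] ut; rewrite ltnNge; apply/negP => ck.
have inE (y : R) d : u y = Some d -> (d <= k)%N -> y <= sup E.
  by move=> uy dk; apply: sup_upper_bound => //; right; exists d.
have [e e0 He] := tval_rcont (val_in ut).
have /andP[s0 sl] := val_in ut.
(* Half of the smaller of [e] and the remaining length: [y] is still inside the word and still
   carries the letter [c], so it belongs to [E] although it exceeds [sup E]. *)
pose y := sup E + t + Num.min e (tlen u - (sup E + t)) / 2.
have m0 : 0 < Num.min e (tlen u - (sup E + t)) by rewrite lt_min e0 subr_gt0.
have m1 : Num.min e (tlen u - (sup E + t)) <= e by rewrite ge_min lexx.
have m2 : Num.min e (tlen u - (sup E + t)) <= tlen u - (sup E + t).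
  by rewrite ge_min lexx orbT.
have : y <= sup E.
  apply: (inE y c) => //; rewrite -ut; apply: He; last by rewrite /y; lra.
  by apply/andP; split; rewrite /y; lra.
by rewrite /y; lra.
Qed.

End Words.

(** * Row insertion *)

Section RowInsertion.
Variables (R : realType) (N : nat).
Local Notation word := (timed_word R N).
Implicit Types (u v w x y z a b : word) (c d e : 'I_N) (s t : R).
Implicit Types (l : seq ('I_N * R)).

(** The branches of [rins1] become one formula, with [b1] the bumped segment: it has length [t], or
    it is all of the part exceeding [c] when that part is too short. *)
Definition cut_at a b1 b2 c t : Prop :=
  [/\ forall d, letter d a -> (d <= c)%N,
      forall d, letter d (b1 :+: b2) -> (c < d)%N
    & tlen b1 = t \/ b2 = tempty /\ tlen b1 <= t].

Lemma row_cut_at u c t : is_row u -> 0 <= t ->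
  exists a b1 b2, u = a :+: (b1 :+: b2) /\ cut_at a b1 b2 c t.
Proof.
move=> /(row_split c)[a [b [-> ha hb]]] t0.
have [tb|/ltW bt] := leP t (tlen b).
  have [|E1 E2] := @tcat_tsub _ _ b t; first by rewrite t0.
  exists a, (tsub b 0 t), (tsub b t (tlen b)); rewrite -E1.
  by split=> //; split=> //; [rewrite -E1|left].
exists a, b, tempty; rewrite tcatw0; split=> //; split=> //.
  by rewrite tcatw0.
by right.
Qed.

Lemma first_exceed_tcat a b c : b != tempty ->
  (forall d, letter d a -> (d <= c)%N) -> (forall d, letter d b -> (c < d)%N) ->
  first_exceed (a :+: b) c = tlen a.
Proof.
move=> b0 ha hb; apply: xget_unique => [|s [hs1 hs2]].
  split=> [|t [d]].
    have [|d bd ld] := @tval_letter _ _ b 0; first by rewrite lexx tlen_gt0.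
    by exists d; [rewrite -[tlen a]addr0 tcat_valr|apply: hb].
  have [//|ta] := leP (tlen a) t.
  rewrite tcat_vall // => at_d cd.
  by have := ha d (ex_intro _ t at_d); rewrite leqNgt cd.
apply/le_anti/andP; split.
  apply: hs2; have [|d bd ld] := @tval_letter _ _ b 0; first by rewrite lexx tlen_gt0.
  by exists d; [rewrite -[tlen a]addr0 tcat_valr|apply: hb].
have [d sd cd] := hs1; rewrite leNgt; apply/negP => sa.
rewrite tcat_vall // in sd.
by have := ha d (ex_intro _ s sd); rewrite leqNgt cd.
Qed.

Lemma rins1E a b1 b2 c t : cut_at a b1 b2 c t ->
  rins1 (a :+: (b1 :+: b2)) c t = (b1, a :+: tpow c t :+: b2).
Proof.
case=> ha hb ht; rewrite /rins1.
have [b0|b0] := eqVneq (b1 :+: b2) tempty.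
  have [-> ->] := tcat_eq0 b0; rewrite !tcatw0 ifT //.
  by apply/asboolP => s d asd; apply: ha; exists s.
rewrite ifF; last first.
  apply/negbTE/asboolP => h; have [d db] := neq0_letter b0.
  have [s sd] : letter d (a :+: (b1 :+: b2)) by apply/letter_tcat; right.
  by have := hb d db; rewrite ltnNge (h s d sd).
rewrite first_exceed_tcat //=.
have Ea : tsub (a :+: (b1 :+: b2)) 0 (tlen a) = a.
  by have := tsub_mid tempty a (b1 :+: b2); rewrite tcat0w /= add0r.
rewrite Ea [tlen a + _]addrC addrK.
have b10 := tlen_ge0 b1; have b20 := tlen_ge0 b2.
case: ifPn => tb.
  have Et : tlen b1 = t.
    by case: ht => // -[b2E]; move: tb; rewrite b2E /= addr0 ltNge => /negPf->.
  congr (_, _ :+: _); first by rewrite -Et tcatA tsub_mid.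
  have := tsub_mid (a :+: b1) b2 tempty.
  by rewrite tcatw0 /= Et -tcatA [_ + tlen a]addrC addrA.
have b2E : b2 = tempty.
  case: ht => [Et|[]//]; apply: tlen0_tempty; apply/le_anti; rewrite b20 andbT.
  by move: tb; rewrite Et -leNgt; lra.
move: b20 tb; rewrite b2E !tcatw0 /= addr0 (addrC (tlen b1)) => _ _.
by congr (_, _); have := tsub_mid a b1 tempty; rewrite tcatw0.
Qed.

Lemma rins1P u c t : is_row u -> 0 <= t -> exists a b1 b2,
  [/\ u = a :+: (b1 :+: b2), cut_at a b1 b2 c t
    & rins1 u c t = (b1, a :+: tpow c t :+: b2)].
Proof.
move=> ru t0; have [a [b1 [b2 [-> h]]]] := row_cut_at c ru t0.
by exists a, b1, b2; split=> //; apply: rins1E.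
Qed.

Lemma rins1_row u c t : is_row u -> 0 <= t -> is_row (rins1 u c t).2.
Proof.
move=> ru t0; have [a [b1 [b2 [uE [ha hb ht] ->]]]] := rins1P c ru t0.
move: ru; rewrite uE => /is_row_tcat[ra /is_row_tcat[rb1 rb2 _] _] /=.
apply/is_row_tcat; split=> //.
  apply/is_row_tcat; split=> //; first exact: is_row_tpow.
  by move=> d e /ha da /letter_tpow[->].
move=> d e /letter_tcat[/ha da|/letter_tpow[-> _]] eb2.
  by rewrite (leq_trans da) // ltnW // hb // letter_tcat; right.
by rewrite ltnW // hb // letter_tcat; right.
Qed.

Lemma rins10 u c : is_row u -> rins1 u c 0 = (tempty, u).
Proof.
move=> ru; have [a [b1 [b2 [uE [_ _ ht] ->]]]] := rins1P c ru (lexx 0).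
have b10 : b1 = tempty.
  by apply/tlen0_tempty; case: ht => // -[_ h]; apply/le_anti; rewrite h tlen_ge0.
by rewrite uE b10 tpow0 // tcat0w tcatw0.
Qed.

(** The second insertion finds its cut just behind the [c^s] already placed, so it bumps the
    beginning of what the first insertion left above [c]. *)
Lemma rins1D u c s t : is_row u -> 0 <= s -> 0 <= t ->
  rins1 u c (s + t) =
  ((rins1 u c s).1 :+: (rins1 (rins1 u c s).2 c t).1,
   (rins1 (rins1 u c s).2 c t).2).
Proof.
move=> ru s0 t0; have [a [b1 [b2 [uE [ha hb hs] E]]]] := rins1P c ru s0.
have rb2 : is_row b2 by move: ru; rewrite uE => /is_rowr/is_rowr.
have [b3 [b4 [b2E ht]]] : exists b3 b4, b2 = b3 :+: b4 /\
    (tlen b3 = t \/ b4 = tempty /\ tlen b3 <= t).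
  have [tb|/ltW bt] := leP t (tlen b2).
    have [|E1 E2] := @tcat_tsub _ _ b2 t; first by rewrite t0.
    by exists (tsub b2 0 t), (tsub b2 t (tlen b2)); split=> //; left.
  by exists b2, tempty; rewrite tcatw0; split=> //; right.
have E2 : rins1 (a :+: tpow c s :+: (b3 :+: b4)) c t =
    (b3, a :+: tpow c s :+: tpow c t :+: b4).
  apply: rins1E; split=> // d.
    by case/letter_tcat=> [/ha|/letter_tpow[->]].
  by rewrite -b2E => h; apply: hb; apply/letter_tcat; right.
rewrite E /= b2E E2 /= uE b2E -(tcatA a) tpowD // (tcatA b1) rins1E //.
split=> //; first by move=> d; rewrite -tcatA -b2E; apply: hb.
case: hs => [hs|[b20 hs]].
  by case: ht => [ht|[b40 ht]]; [left|right; split=> //] => /=; rewrite hs ?ht ?lerD2l.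
have [b30 b40] : b3 = tempty /\ b4 = tempty by apply: tcat_eq0; rewrite -b2E.
by right; split=> //=; rewrite b30 /= addr0 ler_wpDr.
Qed.

(** Insertion along an arbitrary expression, with zero exponents and repeated letters allowed;
    [rins] is the case of the reduced expression. *)
Fixpoint rins_seq u l : word * word :=
  if l is p :: l' then
    ((rins1 u p.1 p.2).1 :+: (rins_seq (rins1 u p.1 p.2).2 l').1,
     (rins_seq (rins1 u p.1 p.2).2 l').2)
  else (tempty, u).

Definition nonneg l := all (fun p => 0 <= p.2) l.
Definition expr l : word := \big[@tcat R N/tempty]_(p <- l) tpow p.1 p.2.

Lemma expr_cons c t l : expr ((c, t) :: l) = tpow c t :+: expr l.
Proof. by rewrite /expr big_cons. Qed.

Lemma expr_cat l l' : expr (l ++ l') = expr l :+: expr l'.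
Proof. exact: big_cat. Qed.

Lemma rins_reduced u v : rins u v = rins_seq u (reduced_expr v).
Proof.
rewrite /rins; set F := fun _ _ => _.
suff H l w u' : foldl F (w, u') l = (w :+: (rins_seq u' l).1, (rins_seq u' l).2).
  by rewrite H tcat0w; case: rins_seq.
elim: l w u' => [|[c t] l IH] w u' /=; first by rewrite tcatw0.
by case: rins1 => v' u''; rewrite IH /= tcatA.
Qed.

Lemma rins_seq_row u l : is_row u -> nonneg l -> is_row (rins_seq u l).2.
Proof.
by elim: l u => [|[c t] l IH] u //= ru /andP[t0 l0]; apply/IH/l0/rins1_row.
Qed.

Lemma rins_seq_cat u l l' : rins_seq u (l ++ l') =
  ((rins_seq u l).1 :+: (rins_seq (rins_seq u l).2 l').1,
   (rins_seq (rins_seq u l).2 l').2).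
Proof.
elim: l u => [|p l IH] u /=; first by rewrite tcat0w; case: rins_seq.
by rewrite IH /= tcatA.
Qed.

(** The value at 0 gives the first letter. If its exponents differed, then at the end of the shorter
    one the longer word would still show that letter, while the shorter one has ended or moved on to
    a different letter. *)
Lemma reduced_expr_uniq w l l' :
  is_reduced_expr w l -> is_reduced_expr w l' -> l = l'.
Proof.
case=> p1 s1 -> {w} [p2 s2]; rewrite -!/(expr _) => E.
wlog suff H : / forall l l', all (fun p => 0 < p.2) l ->
    all (fun p => 0 < p.2) l' -> sorted (fun p q => p.1 != q.1) l ->
    sorted (fun p q => p.1 != q.1) l' -> expr l = expr l' -> l = l'.
  exact: H.
move=> {l l' p1 s1 p2 s2 E}; elim=> [|[c t] l IH] [|[c' t'] l'] //.
- move=> _ /= /andP[t0 _] _ _; rewrite expr_cons /expr big_nil => /esym/tcat_eq0[h _].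
  by have := tpow_neq0 c' t0; rewrite h eqxx.
- move=> /= /andP[t0 _] _ _ _; rewrite expr_cons /expr big_nil => /tcat_eq0[h _].
  by have := tpow_neq0 c t0; rewrite h eqxx.
move=> /= /andP[t0 p] /andP[t0' p'] s s'; rewrite !expr_cons => E.
have val0 k r (m : seq ('I_N * R)) : 0 < r -> (tpow k r :+: expr m) 0 = Some k.
  move=> r0; rewrite tcat_vall ?tlen_tpow ?(ltW r0) //= /tpow_val lexx lt_max r0.
  by rewrite orbT.
have cc : c = c' by apply: Some_inj; rewrite -(val0 c t l) // E val0.
have noless (r r' : R) (m m' : seq ('I_N * R)) : 0 < r -> r < r' ->
    all (fun p => 0 < p.2) m -> path (fun p q => p.1 != q.1) (c, r) m ->
    tpow c r :+: expr m = tpow c r' :+: expr m' -> False.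
  move=> r0 rr' pm sm Em.
  have r0' := lt_trans r0 rr'.
  have : (tpow c r :+: expr m) (tlen (tpow c r) + 0) = Some c.
    rewrite Em addr0 (tlen_tpow c (ltW r0)) tcat_vall ?tlen_tpow ?(ltW r0') //=.
    by rewrite /tpow_val (ltW r0) lt_max rr' orbT.
  rewrite tcat_valr //.
  case: m pm sm {Em} => [|[d q] m] /=; first by rewrite /expr big_nil.
  by move=> /andP[q0 _] /andP[/eqP cd _]; rewrite expr_cons val0 // => -[/esym].
subst c'; have [tt'|tt'|tt'] := ltgtP t t'.
- by case: (noless t t' l l').
- by case: (noless t' t l' l) => //; rewrite E.
subst t'; congr cons; apply: IH => //; [exact: path_sorted s|exact: path_sorted s'|].
exact: tcat_inj E.
Qed.

(* Zero exponents and repeated letters are harmless, so that a row can be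
   inserted along any of its expressions. *)
Lemma rins_expr u l : is_row u -> nonneg l -> rins u (expr l) = rins_seq u l.
Proof.
move=> ru l0.
(* The reduced expression is built along [l]: zero exponents disappear by [rins10], equal neighbours
   merge by [rins1D]. The claim ranges over all rows because the head of the list changes the row
   into which the tail is inserted. *)
have [r [rr E]] : exists r, is_reduced_expr (expr l) r /\
    forall u, is_row u -> rins_seq u r = rins_seq u l.
  elim: l l0 {u ru} => [_|[c t] l IH /= /andP[t0 /IH[r [[pr sr rE] E]]]].
    by exists [::].
  have [tp|t_le0] := ltP 0 t; last first.
    have -> : t = 0 by apply/le_anti; rewrite t0 t_le0.
    exists r; rewrite expr_cons tpow0 // tcat0w; split=> // u ru.
    by rewrite E // rins10 //= tcat0w; case: rins_seq.
  case: r pr sr rE E => [|[d s] r] /= pr sr rE E.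
    exists [:: (c, t)]; split=> [|u ru].
      split=> //=; first by rewrite tp.
      by rewrite expr_cons rE big_nil big_seq1 tcatw0.
    by rewrite /= -E //; apply: rins1_row.
  have [cd|cd] := eqVneq c d.
    subst d; have s0 : 0 < s by case/andP: pr.
    exists ((c, t + s) :: r); split=> [|u ru].
      split=> /=; first by rewrite addr_gt0 //; case/andP: pr.
        by case: (r) sr.
      by rewrite expr_cons rE !big_cons tcatA tpowD // ltW.
    rewrite /= -E ?rins1D ?(ltW s0) //=; last exact: rins1_row.
    by rewrite tcatA.
  exists ((c, t) :: (d, s) :: r); split=> [|u ru].
    split=> /=; first by rewrite tp.
      by rewrite cd.
    by rewrite expr_cons rE !big_cons.
  by rewrite -E //; apply: rins1_row.
rewrite rins_reduced /reduced_expr (xget_unique _ rr) ?E // => r' rr'.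
exact: reduced_expr_uniq rr' rr.
Qed.
End RowInsertion.

(** * Letters and bumped words under row insertion *)

Section RowInsertionLetters.
Variables (R : realType) (N : nat).
Local Notation word := (timed_word R N).
Implicit Types (u v w x y z a b : word) (c d e : 'I_N) (s t : R).
Implicit Types (l : seq ('I_N * R)).

Definition letter_le : rel ('I_N * R) := fun p q => (p.1 <= q.1)%N.

Lemma row_const c w : (forall d, letter d w -> d = c) -> w = tpow c (tlen w).
Proof.
move=> h; apply: word_eq => t /=; rewrite /tpow_val (max_idPr (tlen_ge0 w)).
have := tval_dom w t; case E: (w t) => [d|] <- //=.
by congr Some; apply: h; exists t.
Qed.

Lemma row_expr v : is_row v ->
  exists l, [/\ nonneg l, sorted letter_le l & v = expr l].
Proof.
move=> rv.
(* Only the [k] largest letters may occur in [w]. Splitting at [N - k.+1] isolates an initial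
   segment on a single letter; for [N <= k] the subtraction truncates, and the claim for [k] applies
   directly. *)
suff H k w : is_row w -> (forall c, letter c w -> (N <= c + k)%N) ->
    exists l, [/\ nonneg l, sorted letter_le l, w = expr l
    & all (fun p : 'I_N * R => N <= p.1 + k)%N l].
  have [|l [? ? ? _]] := H N v rv; last by exists l.
  by move=> c _; apply: leq_addl.
elim: k w {v rv} => [|k IH] v rv hv.
  exists [::]; split=> //; rewrite /expr big_nil; apply: no_letter_tempty => c.
  by move=> /hv; rewrite addn0 leqNgt ltn_ord.
have [Nk|kN] := leqP N k.
  have [c _|l [l1 l2 l3 l4]] := IH _ rv; first exact: leq_trans Nk (leq_addl _ _).
  exists l; split=> //; apply: sub_all l4 => p; rewrite addnS; exact: leqW.
have [a [b [vE ha hb]]] := row_split (N - k.+1) rv.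
have rb : is_row b by move: rv; rewrite vE => /is_rowr.
have [c /hb|l [l1 l2 l3 l4]] := IH _ rb.
  by rewrite ltn_subLR // addSn addnC.
have l4' : all (fun p : 'I_N * R => N <= p.1 + k.+1)%N l.
  by apply: sub_all l4 => p; rewrite addnS; exact: leqW.
have [a0|/neq0_letter[c ca]] := eqVneq a tempty.
  by exists l; rewrite vE a0 tcat0w.
have hc d : letter d a -> d = (N - k.+1)%N :> nat.
  move=> da; apply/eqP; rewrite eqn_leq ha // leq_subLR addnC hv //.
  by rewrite vE letter_tcat; left.
exists ((c, tlen a) :: l); split=> /=.
- by rewrite tlen_ge0.
- rewrite path_min_sorted //; apply: sub_all l4 => p.
  by rewrite /letter_le /= (hc c ca) leq_subLR addSn addnC => /leqW.
- rewrite expr_cons -l3 vE -row_const // => d da.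
  by apply: val_inj; rewrite /= !hc.
- by rewrite l4' andbT hv // vE letter_tcat; left.
Qed.

Lemma letter_expr_cons d c t l :
  letter d (expr ((c, t) :: l)) <-> d = c /\ 0 < t \/ letter d (expr l).
Proof. by rewrite expr_cons letter_tcat letter_tpow. Qed.

(** The bumped part [b1] starts beyond the letters at most [c] and precedes [b2], the only place
    where letters above [c] remain. *)
Lemma rins1_lt u c t d : is_row u -> 0 <= t -> letter d (rins1 u c t).1 ->
  [/\ letter d u, (c < d)%N, letter c (rins1 u c t).2
    & forall e, letter e (rins1 u c t).2 -> (c < e)%N -> (d <= e)%N].
Proof.
move=> ru t0; have [a [b1 [b2 [uE [ha hb ht] ->]]]] := rins1P c ru t0.
move=> /= db1; split.
- by rewrite uE !letter_tcat; right; left.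
- by apply: hb; rewrite letter_tcat; left.
- rewrite !letter_tcat letter_tpow; left; right; split=> //.
  have b1_gt0 : 0 < tlen b1 by apply/tlen_gt0/letter_neq0/db1.
  by case: ht => [<-//|[_]]; apply: lt_le_trans.
- move=> e /letter_tcat[/letter_tcat[/ha ec|/letter_tpow[-> _]]|eb2] ce.
  + by have := leq_ltn_trans ec ce; rewrite ltnn.
  + by rewrite ltnn in ce.
  + move: ru; rewrite uE => /is_rowr/is_row_tcat[_ _]; exact.
Qed.

(** A letter that is bumped away leaves the smaller letter [c] behind. *)
Lemma rins1_old u c t e : is_row u -> 0 <= t -> letter e u ->
  exists2 d, letter d (rins1 u c t).2 & (d <= e)%N.
Proof.
move=> ru t0 eu.
have := @rins1_lt u c t e ru t0.
have [a [b1 [b2 [uE [ha hb ht] ->]]]] := rins1P c ru t0 => /= lt1.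
move: eu; rewrite uE !letter_tcat => -[ea|[/lt1[_ ce lc _]|eb2]].
- by exists e => //; rewrite !letter_tcat; left; left.
- by exists c => //; apply: ltnW.
- by exists e => //; rewrite !letter_tcat; right.
Qed.

Lemma rins1_new u c t e : is_row u -> 0 <= t -> letter e (rins1 u c t).2 ->
  letter e u \/ e = c /\ 0 < t.
Proof.
move=> ru t0; have [a [b1 [b2 [uE [ha hb ht] ->]]]] := rins1P c ru t0.
rewrite /= uE !letter_tcat letter_tpow => -[[]|]; by [auto|left; auto|right].
Qed.

Lemma rins_seq_old u l e : is_row u -> nonneg l -> letter e u ->
  exists2 d, letter d (rins_seq u l).2 & (d <= e)%N.
Proof.
elim: l u e => [|[c t] l IH] u e /= ru; first by exists e.
move=> /andP[t0 l0] /(rins1_old c ru t0)[d du de].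
have [f fd fe] := IH _ _ (rins1_row ru t0) l0 du.
by exists f => //; apply: leq_trans de.
Qed.

(** The letter that bumps [d] may be bumped itself later on, but by [rins_seq_old] some letter at
    most as large survives. *)
Lemma rins_seq_lt u l d : is_row u -> nonneg l -> letter d (rins_seq u l).1 ->
  exists2 c, letter c (rins_seq u l).2 & (c < d)%N.
Proof.
elim: l u d => [|[c t] l IH] u d /= ru; first by move=> _ /letter_tempty.
move=> /andP[t0 l0] /letter_tcat[/(rins1_lt ru t0)[_ cd lc _]|].
  have [f fd fc] := rins_seq_old (rins1_row ru t0) l0 lc.
  by exists f => //; apply: leq_ltn_trans cd.
exact: IH (rins1_row ru t0) l0.
Qed.

Lemma rins_seq_new u l e : is_row u -> nonneg l -> letter e (rins_seq u l).2 ->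
  letter e u \/ letter e (expr l).
Proof.
elim: l u => [|[c t] l IH] u /= ru; first by left.
move=> /andP[t0 l0] /(IH _ (rins1_row ru t0) l0)[/(rins1_new ru t0)[]|h].
- by left.
- by move=> h; right; apply/letter_expr_cons; left.
- by right; apply/letter_expr_cons; right.
Qed.

(** After an insertion of [c], the letters above [c] are at least those just bumped, and with
    increasing insertions only these can be bumped later. Letters newly placed are never large
    enough to be bumped again, so everything bumped comes from [u]. *)
Lemma rins_seq_bumped u l c : is_row u -> nonneg l ->
  sorted letter_le l -> all (fun p : 'I_N * R => (c <= p.1)%N) l ->
  is_row (rins_seq u l).1 /\
  forall d, letter d (rins_seq u l).1 -> letter d u /\ (c < d)%N.
Proof.
elim: l u c => [|[c t] l IH] u k /= ru; first by split=> // d /letter_tempty.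
move=> /andP[t0 l0] cl /andP[kc kl].
have cl' : all (fun p : 'I_N * R => (c <= p.1)%N) l.
  by apply: order_path_min cl => p q r; apply: leq_trans.
have [r2 h2] := IH _ c (rins1_row (c := c) ru t0) l0 (path_sorted cl) cl'.
split=> [|d /letter_tcat[/(rins1_lt ru t0)[? cd _ _]|/h2[d1 cd]]].
- apply/is_row_tcat; split=> //.
    have [a [b1 [b2 [uE _ ->]]]] := rins1P c ru t0.
    by move: ru; rewrite uE /= => /is_rowr/is_rowl.
  by move=> d e /(rins1_lt ru t0)[_ _ _ de] /h2[e1 e2]; apply: de.
- by split=> //; apply: leq_ltn_trans cd.
- split; last exact: leq_ltn_trans cd.
  case: (rins1_new ru t0 d1) => // -[dc _].
  by rewrite dc ltnn in cd.
Qed.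

Lemma rins_row u v : is_row u -> is_row v -> is_row (rins u v).1 /\ is_row (rins u v).2.
Proof.
move=> ru /row_expr[l [l0 sl ->]]; rewrite rins_expr //.
split; last exact: rins_seq_row.
case: l l0 sl => [|[c t] l] l0 sl; first by [].
apply: (proj1 (@rins_seq_bumped u _ c ru l0 sl _)).
by rewrite /= leqnn; apply: order_path_min sl => p q r; apply: leq_trans.
Qed.

Lemma rins_old u v e : is_row u -> is_row v -> letter e u ->
  exists2 d, letter d (rins u v).2 & (d <= e)%N.
Proof. by move=> ru /row_expr[l [l0 _ ->]]; rewrite rins_expr //; apply: rins_seq_old. Qed.

Lemma rins_lt u v d : is_row u -> is_row v -> letter d (rins u v).1 ->
  exists2 c, letter c (rins u v).2 & (c < d)%N.
Proof. by move=> ru /row_expr[l [l0 _ ->]]; rewrite rins_expr //; apply: rins_seq_lt. Qed.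

Lemma rins_new u v e : is_row u -> is_row v -> letter e (rins u v).2 ->
  letter e u \/ letter e v.
Proof. by move=> ru /row_expr[l [l0 _ ->]]; rewrite rins_expr //; apply: rins_seq_new. Qed.

Lemma rins_tcat u v1 v2 : is_row u -> is_row v1 -> is_row v2 ->
  rins u (v1 :+: v2) =
  ((rins u v1).1 :+: (rins (rins u v1).2 v2).1, (rins (rins u v1).2 v2).2).
Proof.
move=> ru /row_expr[l1 [l10 _ ->]] /row_expr[l2 [l20 _ ->]].
rewrite -expr_cat !rins_expr ?rins_seq_cat //; first exact: rins_seq_row.
by rewrite /nonneg all_cat; apply/andP.
Qed.

Lemma rins_tempty u : is_row u -> rins u tempty = (tempty, u).
Proof. by move=> ru; have := @rins_expr _ _ u [::] ru isT; rewrite /expr big_nil. Qed.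

Lemma rins_append u v : is_row (u :+: v) -> rins u v = (tempty, u :+: v).
Proof.
move=> ruv; have /row_expr[l [l0 _ vE]] := is_rowr ruv.
rewrite vE rins_expr //; last exact: is_rowl ruv.
move: ruv; rewrite {v}vE; elim: l u l0 => [|[c t] l IH] u.
  by rewrite /= /expr big_nil tcatw0.
move=> /= /andP[t0 l0]; rewrite expr_cons tcatA => ruv.
have -> : rins1 u c t = (tempty, u :+: tpow c t).
  have [tp|t_le0] := ltP 0 t; last first.
    have -> : t = 0 by apply/le_anti; rewrite t0 t_le0.
    by rewrite rins10 ?tpow0 ?tcatw0 //; apply/is_rowl/is_rowl/ruv.
  have := @rins1E _ _ u tempty tempty c t; rewrite !tcatw0; apply; split.
  - by move=> d du; move/is_rowl/is_row_tcat: ruv => [_ _]; apply=> //; apply/letter_tpow.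
  - by move=> d; rewrite tcatw0 => /letter_tempty.
  - by right.
by rewrite /= IH //= tcat0w.
Qed.

(** Every cut falls behind [w]. This is why a segment [c^d] stays in place while letters at least
    [c] are inserted. *)
Lemma rins_shift w u v : is_row (w :+: u) -> is_row v ->
  (forall c d, letter c w -> letter d v -> (c <= d)%N) ->
  rins (w :+: u) v = ((rins u v).1, w :+: (rins u v).2).
Proof.
move=> rwu /row_expr[l [l0 _ ->]]; have ru := is_rowr rwu.
rewrite !rins_expr //; elim: l u rwu ru l0 => [|[c t] l IH] u rwu ru //=.
move=> /andP[t0 l0] h.
have h' d e : letter d w -> letter e (expr l) -> (d <= e)%N.
  by move=> dw el; apply: h => //; apply/letter_expr_cons; right.
have [tp|t_le0] := ltP 0 t; last first.
  have -> : t = 0 by apply/le_anti; rewrite t0 t_le0.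
  by rewrite !rins10 //= !tcat0w IH.
have wc d : letter d w -> (d <= c)%N.
  by move=> dw; apply: h => //; apply/letter_expr_cons; left.
have -> : rins1 (w :+: u) c t = ((rins1 u c t).1, w :+: (rins1 u c t).2).
  have [a [b1 [b2 [-> [ha hb ht] ->]]]] := rins1P c ru t0.
  rewrite tcatA rins1E /= ?tcatA //; split=> // d.
  by case/letter_tcat=> [/wc|/ha].
rewrite /= IH //; last exact: rins1_row.
have [rw _ wu] := (is_row_tcat w u).1 rwu.
apply/is_row_tcat; split=> //; first exact: rins1_row.
by move=> d e dw /(rins1_new ru t0)[eu|[-> _]]; [exact: wu|exact: wc].
Qed.

(** All letters exceed [c], so the cut is at 0, and the exponent is chosen so that the bumped
    segment is exactly [w]. *)
Lemma rins_bump w u c : is_row (w :+: u) ->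
  (forall d, letter d (w :+: u) -> (c < d)%N) ->
  rins (w :+: u) (tpow c (tlen w)) = (w, tpow c (tlen w) :+: u).
Proof.
move=> rwu h; have := @rins_expr _ _ (w :+: u) [:: (c, tlen w)] rwu.
rewrite /expr /= big_seq1 /= tlen_ge0 => -> //.
have := @rins1E _ _ tempty w u c (tlen w); rewrite !tcat0w => -> //=.
  by rewrite tcatw0.
by split=> //; [move=> d /letter_tempty|left].
Qed.
End RowInsertionLetters.

(** * Tableaux *)

Section TableauInsertion.
Variables (R : realType) (N : nat).
Local Notation word := (timed_word R N).
Implicit Types (u v w : word) (c d e : 'I_N) (s t : R) (T us vs rs : seq word).

Definition wcat us : word := \big[@tcat R N/tempty]_(u <- us) u.

Lemma wcat_cons u us : wcat (u :: us) = u :+: wcat us.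
Proof. exact: big_cons. Qed.

Lemma wcat_rcons us u : wcat (rcons us u) = wcat us :+: u.
Proof. by rewrite /wcat -cats1 big_cat big_seq1. Qed.

Definition nonempty_row u := (u != tempty) && `[< is_row u >].
Definition breaks u v := ~~ `[< is_row (u :+: v) >].

Lemma breaksP u v : is_row u -> is_row v ->
  breaks u v -> exists c d, [/\ letter c u, letter d v & (d < c)%N].
Proof.
move=> ru rv /asboolPn h; apply: contra_notP h => h.
apply/is_row_tcat; split=> // c d cu dv; rewrite leqNgt; apply/negP => dc.
by apply: h; exists c, d.
Qed.

(** The first row is forced to be as long as possible: a row reaching beyond [u] would contain a
    letter [c] of [u] followed by the first letter of the next row, which is below [c] by the
    descent that [breaksP] extracts. *)
Lemma row_decomposition_uniq w us vs :
  is_row_decomposition w us -> is_row_decomposition w vs -> us = vs.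
Proof.
move=> [-> + +] [+ + +]; rewrite -!/(wcat _).
have longest u us' v vs' : nonempty_row u -> all nonempty_row us' ->
    path breaks u us' -> nonempty_row v ->
    u :+: wcat us' = v :+: wcat vs' -> tlen v <= tlen u.
  move=> /andP[u0 /asboolP ru] rus bus /andP[v0 /asboolP rv] E.
  rewrite leNgt; apply/negP => uv.
  case: us' rus bus E => [|u2 us'] /= => [_ _|/andP[/andP[u20 /asboolP ru2] _]].
    move=> E; have := congr1 (@tlen R N) E; rewrite /wcat big_nil /= addr0 => {}E.
    by move: uv; rewrite E ltNge lerDl tlen_ge0.
  move=> /andP[/(breaksP ru ru2)[c [d [[s usc] [r u2d] dc]]] _].
  have [|e u2e _] := @tval_letter _ _ u2 0; first by rewrite lexx tlen_gt0.
  have [s0 su] := andP (val_in usc); have [r0 _] := andP (val_in u2d).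
  have ed : (e <= d)%N by apply: ru2 u2e u2d.
  rewrite wcat_cons => E.
  have vsc : v s = Some c.
    by rewrite -(tcat_vall (wcat vs') (lt_trans su uv)) -E tcat_vall.
  have ve : v (tlen u) = Some e.
    rewrite -(tcat_vall (wcat vs') uv) -E -[tlen u]addr0 tcat_valr //.
    by rewrite tcat_vall // tlen_gt0.
  have := rv _ _ _ _ (ltW su) vsc ve.
  by rewrite leqNgt (leq_ltn_trans ed dc).
elim: us vs => [|u us IH] [|v vs] //=.
- move=> _ _; rewrite wcat_cons {1}/wcat big_nil => /esym/tcat_eq0[-> _].
  by rewrite eqxx.
- move=> /andP[/andP[u0 _] _] _; rewrite wcat_cons /wcat big_nil => /tcat_eq0[u0' _].
  by rewrite u0' eqxx in u0.
move=> /andP[nu nus] bu E /andP[nv nvs] bv; rewrite !wcat_cons in E.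
have luv : tlen u = tlen v.
  apply/le_anti/andP; split; first exact: longest nv nvs bv nu (esym E).
  exact: longest nu nus bu nv E.
have uv : u = v.
  apply: word_eq => t; have [tu|ut] := ltP t (tlen u).
    by rewrite -(tcat_vall (wcat us) tu) E tcat_vall // -luv.
  have := tval_dom u t; have := tval_dom v t.
  by rewrite -luv ltNge ut andbF; case: (v t) => // _; case: (u t).
subst v; congr cons; apply: IH => //.
- exact: path_sorted bu.
- exact: tcat_inj E.
- exact: path_sorted bv.
Qed.

Lemma row_decompositionE us : all nonempty_row us -> sorted breaks us ->
  row_decomposition (wcat us) = us.
Proof.
move=> h1 h2; have h : is_row_decomposition (wcat us) us by [].
by apply: xget_unique => // vs h'; apply: row_decomposition_uniq h' h.
Qed.

(** The rows are listed from [u_1] upwards, and an empty word creates no new row, so that the list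
    remains a candidate for a row decomposition. *)
Fixpoint insert_seq T v : seq word :=
  if T is u :: T' then (rins u v).2 :: insert_seq T' (rins u v).1
  else if v == tempty then [::] else [:: v].

(** A consequence of the columnwise relation between [u] and [v] that speaks of letters instead of
    positions. It is stable under insertion and puts a descent between non-empty neighbouring rows
    of the word. *)
Definition above u v := `[< forall d, letter d v -> exists2 c, letter c u & (c < d)%N >].

Definition is_tableau T := all nonempty_row T && sorted above T.

Lemma nonempty_row_rins u v : nonempty_row u -> is_row v -> nonempty_row (rins u v).2.
Proof.
move=> /andP[/neq0_letter[c cu] /asboolP ru] rv; apply/andP; split.
  by have [d du _] := rins_old ru rv cu; apply: letter_neq0 du.
by apply/asboolP; case: (rins_row ru rv).
Qed.

(** A letter of the new second row is either old, and then the smaller letter below it is kept or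
    replaced by one at most as large ([rins_old]), or it has just been bumped, and then [rins_lt]
    provides a smaller one. *)
Lemma insert_seq_tableau T v : is_tableau T -> is_row v -> is_tableau (insert_seq T v).
Proof.
elim: T v => [|u T IH] v /=.
  move=> _ rv; case: eqP => // /eqP v0; rewrite /is_tableau /= andbT.
  by rewrite /nonempty_row v0; apply/andP; split=> //; apply/asboolP.
rewrite /is_tableau /= => /andP[/andP[nu nT] aT] rv.
have ru : is_row u by case/andP: nu => _ /asboolP.
have [rv' ru'] := rins_row ru rv.
have /andP[h1 h2] : is_tableau (insert_seq T (rins u v).1).
  by apply: IH => //; rewrite /is_tableau nT (path_sorted aT).
rewrite nonempty_row_rins // h1 /=.
case: T {IH} nT aT h1 h2 => [|u2 T] /=.
  move=> _ _; case: ifP => //= _ _ _; rewrite andbT.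
  by apply/asboolP => d; apply: rins_lt.
move=> /andP[/andP[_ /asboolP ru2] _] /andP[/asboolP a2 _] _ h2.
apply/andP; split=> //; apply/asboolP => d.
case/(rins_new ru2 rv') => [/a2[c cu cd]|]; last exact: rins_lt.
have [e eu ec] := rins_old ru rv cu; exists e => //; exact: leq_ltn_trans cd.
Qed.

Lemma insert_seq_tempty T : all nonempty_row T -> insert_seq T tempty = T.
Proof.
elim: T => [|u T IH] /=; first by rewrite eqxx.
by move=> /andP[/andP[_ /asboolP ru] nT]; rewrite rins_tempty //= IH.
Qed.

(** The words bumped by [v1] and then by [v2] concatenate to a row again ([rins_row]), which is what
    the induction on [T] needs. *)
Lemma insert_seq_tcat T v1 v2 : all nonempty_row T -> is_row (v1 :+: v2) ->
  insert_seq T (v1 :+: v2) = insert_seq (insert_seq T v1) v2.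
Proof.
elim: T v1 v2 => [|u T IH] v1 v2 /=.
  move=> _ rv; have [->|v10] := eqVneq v1 tempty; first by rewrite tcat0w.
  rewrite /= rins_append //= eqxx; case: eqP => // /tcat_eq0[v1E _].
  by rewrite v1E eqxx in v10.
move=> /andP[/andP[_ /asboolP ru] nT] rv.
have [rv1 rv2 _] := (is_row_tcat v1 v2).1 rv.
have [] := rins_row ru rv; rewrite rins_tcat //= => h _.
by rewrite IH.
Qed.

Lemma insert_rowsE T v : insert_rows T v = wcat (rev (insert_seq T v)).
Proof.
elim: T v => [|u T IH] v /=.
  by case: eqP => [->|_]; rewrite /wcat ?big_nil ?big_seq1.
by case: (rins u v) => v' u'; rewrite IH rev_cons wcat_rcons.
Qed.

Lemma tableau_decomposition T : is_tableau T ->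
  row_decomposition (wcat (rev T)) = rev T.
Proof.
move=> /andP[nT aT]; apply: row_decompositionE; first by rewrite all_rev.
rewrite rev_sorted; apply: (sub_in_sorted (P := nonempty_row)) nT aT => u v.
move=> /andP[u0 _] /andP[/neq0_letter[d dv] _] /asboolP uv.
apply/asboolP => r; have [c cu cd] := uv d dv.
by have [_ _ /(_ _ _ dv cu)] := (is_row_tcat v u).1 r; rewrite leqNgt cd.
Qed.

Lemma foldl_insertE T vs : is_tableau T -> all (fun v => `[< is_row v >]) vs ->
  foldl (@insert R N) (wcat (rev T)) vs = wcat (rev (foldl insert_seq T vs)).
Proof.
elim: vs T => [|v vs IH] T //= hT /andP[/asboolP rv rvs].
rewrite -IH //; last exact: insert_seq_tableau.
by rewrite /insert tableau_decomposition // revK insert_rowsE.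
Qed.

(** Rows read off a matrix may be empty or continue one another. Dropping the empty ones and merging
    [r] with the first row of the rest, where possible, yields the row decomposition with the same
    effect on tableaux. *)
Lemma row_decomposition_ex rs : all (fun v => `[< is_row v >]) rs ->
  exists vs, [/\ all nonempty_row vs, sorted breaks vs, wcat vs = wcat rs
    & forall T, is_tableau T -> foldl insert_seq T vs = foldl insert_seq T rs].
Proof.
elim: rs => [|r rs IH] /=; first by exists [::].
move=> /andP[/asboolP rr /IH[vs [nvs bvs vsE fvs]]].
have [r0|r0] := eqVneq r tempty.
  exists vs; rewrite wcat_cons r0 tcat0w; split=> // T hT.
  by rewrite insert_seq_tempty ?fvs //; case/andP: hT.
have nr : nonempty_row r by rewrite /nonempty_row r0; apply/asboolP.
case: vs nvs bvs vsE fvs => [|v vs] /= nvs bvs vsE fvs.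
  exists [:: r]; rewrite /= nr !wcat_cons vsE; split=> // T hT.
  by rewrite -fvs //; apply: insert_seq_tableau.
have /andP[nv nvs'] := nvs; have /andP[v0 /asboolP rv] := nv.
have [/asboolP rrv|brv] := boolP `[< is_row (r :+: v) >]; last first.
  exists [:: r, v & vs]; split=> /=; rewrite ?nr ?nvs //.
  - by rewrite {1}/breaks brv.
  - by rewrite !wcat_cons -vsE wcat_cons.
  - by move=> T hT; rewrite -fvs //; apply: insert_seq_tableau.
exists ((r :+: v) :: vs); split=> /=.
- rewrite nvs' andbT; apply/andP; split; last exact/asboolP.
  by apply/eqP => /tcat_eq0[_ vE]; rewrite vE eqxx in v0.
(* [v] is a suffix of the merged row, so a break after [v] is also a break after [r :+: v]. *)
- case: vs bvs {nvs vsE fvs} nvs' => [|v2 vs] //= /andP[bv ->].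
  move=> /andP[/andP[_ /asboolP rv2] _]; rewrite andbT.
  by apply: contra bv => /asboolP; rewrite -tcatA => /is_rowr ?; apply/asboolP.
- by rewrite !wcat_cons -vsE wcat_cons tcatA.
- move=> T hT; rewrite -fvs; last exact: insert_seq_tableau.
  by rewrite insert_seq_tcat //; case/andP: hT.
Qed.

Lemma tableauP_rows rs : all (fun v => `[< is_row v >]) rs ->
  tableauP (wcat rs) = wcat (rev (foldl insert_seq [::] rs)).
Proof.
move=> /row_decomposition_ex[vs [nvs bvs <- <-]] //.
rewrite /tableauP row_decompositionE //.
case: vs nvs bvs => [|u us] /=; first by rewrite /wcat big_nil.
move=> /andP[/andP[u0 ru] nus] _.
have := @foldl_insertE [:: u] us; rewrite (negPf u0) /wcat big_seq1; apply.
  by rewrite /is_tableau /= /nonempty_row u0 ru.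
by apply: sub_all nus => v /andP[].
Qed.

(* The rows [r 0, r 1, ...] are inserted; [W i] is the first row of the tableau
   before the insertion of [r i], which bumps [s i] into the rows above. *)
Lemma wcat_first_row (m : nat) (W : nat -> word) (r s : 'I_m -> word) :
  W 0%N = tempty -> (forall i, is_row (W i)) -> (forall i, is_row (r i)) ->
  (forall i : 'I_m, rins (W i) (r i) = (s i, W i.+1)) ->
  wcat (rev (foldl insert_seq [::] [seq r i | i <- enum 'I_m])) =
  wcat (rev (foldl insert_seq [::] [seq s i | i <- enum 'I_m])) :+: W m.
Proof.
move=> W0 rW rr h.
pose cons' u T := if u == tempty then T else u :: T.
have wcons u T : wcat (rev (cons' u T)) = wcat (rev T) :+: u.
  by rewrite /cons'; case: eqP => [->|_]; rewrite ?tcatw0 // rev_cons wcat_rcons.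
pose F (f : 'I_m -> word) k :=
  foldl insert_seq [::] [seq f i | i <- take k (enum 'I_m)].
(* As long as [W k] is empty, the tableau has no first row to list; the second conjunct ensures that
   no rows sit above an empty one. *)
suff H k : (k <= m)%N -> F r k = cons' (W k) (F s k) /\ (W k = tempty -> F s k = [::]).
  have [E _] := H m (leqnn m).
  by move: E; rewrite /F take_oversize ?size_enum_ord // => ->; rewrite wcons.
elim: k => [|k IH] km.
  by rewrite /F take0 /cons' W0 eqxx.
have [IH1 IH2] := IH (ltnW km).
have FS f : F f k.+1 = insert_seq (F f k) (f (Ordinal km)).
  rewrite /F (take_nth (Ordinal km)) ?size_enum_ord //.
  rewrite (nth_ord_enum _ (Ordinal km)) -cats1 map_cat foldl_cat //.
have rk := rr (Ordinal km); have hk := h (Ordinal km); rewrite /= in hk.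
rewrite !FS IH1 /cons'.
have [Wk|Wk] := eqVneq (W k) tempty.
  rewrite IH2 //; move: hk; rewrite Wk rins_append ?tcat0w // => -[<- <-].
  by rewrite /= eqxx.
have : W k.+1 != tempty.
  have /andP[] // : nonempty_row (rins (W k) (r (Ordinal km))).2.
    by apply: nonempty_row_rins => //; apply/andP; split=> //; apply/asboolP.
  by rewrite hk.
by move=> Wk1; rewrite (negPf Wk1) /= hk; split=> // E; rewrite E eqxx in Wk1.
Qed.
End TableauInsertion.

(** * Matrices *)

Section ContentWords.
Variables (R : realType) (N : nat).
Implicit Types (f g : 'I_N -> R) (c d : 'I_N) (l : seq 'I_N).

Definition content_word f : timed_word R N :=
  \big[@tcat R N/tempty]_(j < N) tpow j (f j).

Lemma letter_big l f d :
  letter d (\big[@tcat R N/tempty]_(j <- l) tpow j (f j)) <-> d \in l /\ 0 < f d.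
Proof.
elim: l => [|j l IH]; first by rewrite big_nil; split=> [/letter_tempty|[]].
rewrite big_cons letter_tcat letter_tpow IH inE; split.
  by case=> [[-> ->]|[-> ->]]; rewrite ?eqxx ?orbT.
by case=> /orP[/eqP ->|dl] fd; [left|right].
Qed.

Lemma letter_content f d : letter d (content_word f) <-> 0 < f d.
Proof. by rewrite letter_big mem_index_enum; split=> [[]|]. Qed.

Lemma sorted_index_enum : sorted (fun i j : 'I_N => (i < j)%N) (index_enum 'I_N).
Proof.
by have := iota_ltn_sorted 0 N; rewrite -val_enum_ord sorted_map enumT [index_enum _]unlock.
Qed.

Lemma sorted_ltn_lt c l d :
  sorted (fun i j : 'I_N => (i < j)%N) (c :: l) -> d \in l -> (c < d)%N.
Proof.
move=> sl; have /allP : all (fun d : 'I_N => (c < d)%N) l; last exact.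
by apply: order_path_min sl => y x z; apply: ltn_trans.
Qed.

Lemma content_word_row f : is_row (content_word f).
Proof.
rewrite /content_word; elim: index_enum sorted_index_enum => [|j l IH] sl.
  by rewrite big_nil; apply: is_row_tempty.
rewrite big_cons; apply/is_row_tcat; split; first exact: is_row_tpow.
  by apply: IH; apply: path_sorted sl.
move=> c d /letter_tpow[-> _] /letter_big[dl _]; apply: ltnW.
exact: sorted_ltn_lt dl.
Qed.

Lemma content_wordD f g : (forall j, 0 <= f j) -> (forall j, 0 <= g j) ->
  (forall c d, 0 < f c -> 0 < g d -> (c <= d)%N) ->
  content_word f :+: content_word g = content_word (fun j => f j + g j).
Proof.
move=> f0 g0 fg; rewrite /content_word.
elim: index_enum sorted_index_enum => [|j l IH] sl; first by rewrite !big_nil tcat0w.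
rewrite !big_cons -IH ?(path_sorted sl) // -tpowD //.
have [gj|gj] := ltP 0 (g j); last by rewrite (tpow0 j gj) tcat0w tcatw0 tcatA.
suff -> : \big[@tcat R N/tempty]_(j0 <- l) tpow j0 (f j0) = tempty.
  by rewrite tcatw0 tcat0w tcatA.
apply: no_letter_tempty => c /letter_big[cl fc].
by have := sorted_ltn_lt sl cl; rewrite ltnNge fg.
Qed.

Lemma content_word_single c (t : R) :
  content_word (fun j => t *+ (j == c)) = tpow c t.
Proof.
rewrite /content_word -(@big_pred1_eq _ _ (@tcat R N) _ c (fun j => tpow j t)).
rewrite [RHS]big_mkcond; apply: eq_bigr => j _.
by case: eqP => _; rewrite ?mulr1n // mulr0n tpow0.
Qed.

Lemma content_word0 f : (forall j, f j = 0) -> content_word f = tempty.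
Proof.
by move=> f0; apply: no_letter_tempty => c /letter_content; rewrite f0 ltxx.
Qed.

Lemma tpow_content_word c (t : R) f : 0 <= t -> (forall j, 0 <= f j) ->
  (forall d, 0 < f d -> (c <= d)%N) ->
  tpow c t :+: content_word f = content_word (fun j => t *+ (j == c) + f j).
Proof.
move=> t0 f0 cf; rewrite -content_word_single content_wordD // => [j|k d].
  by case: eqP; rewrite ?mulr0n.
by case: eqP => [-> _ /cf|_]; rewrite ?mulr0n ?ltxx.
Qed.

End ContentWords.

(** * Leading points and shadow points *)

Section LeadingPoints.
Variables (R : realType) (m n : nat).
Implicit Types (A S : 'M[R]_(m, n)) (x y z : 'I_m * 'I_n).
Implicit Types (L : seq ('I_m * 'I_n)) (d : R).

Definition precedes : rel ('I_m * 'I_n) :=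
  fun x y => (x.2 < y.2)%N && (y.1 < x.1)%N.

Lemma precedes_trans : transitive precedes.
Proof.
move=> y x z /andP[h1 h2] /andP[h3 h4].
by rewrite /precedes (ltn_trans h1 h3) (ltn_trans h4 h2).
Qed.

Lemma leading_setP A x : reflect
  (0 < A x.1 x.2 /\ forall y, 0 < A y.1 y.2 -> point_le y x -> y = x)
  (x \in leading_set A).
Proof.
rewrite !inE; apply: (iffP andP) => -[h1 h2]; split=> //.
  by move=> y y0 yx; move/forall_inP: h2 => /(_ y); rewrite inE yx => /(_ y0)/eqP.
by apply/forall_inP => y; rewrite inE => y0; apply/implyP => yx; rewrite (h2 y).
Qed.

Lemma mem_leading_points A x : (x \in leading_points A) = (x \in leading_set A).
Proof. by rewrite mem_sort mem_enum. Qed.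

Lemma leading_pointP A x : reflect
  (0 < A x.1 x.2 /\ forall y, 0 < A y.1 y.2 -> point_le y x -> y = x)
  (x \in leading_points A).
Proof. by rewrite mem_leading_points; apply: leading_setP. Qed.

(** Descent on [i + j]: a point that is not minimal dominates one with a smaller sum. *)
Lemma leading_point_le A i j : 0 < A i j ->
  exists2 x, x \in leading_points A & (x.1 <= i)%N && (x.2 <= j)%N.
Proof.
move: {2}(i + j)%N (leqnn (i + j)) => k; elim: k i j => [|k IH] i j ijk Aij.
  exists (i, j); last by rewrite !leqnn.
  apply/leading_pointP; split=> // -[i' j'] _ /andP[/= h1 h2].
  by congr pair; apply: val_inj => /=; lia.
have [h|h] := boolP ((i, j) \in leading_points A).
  by exists (i, j); rewrite ?leqnn.
have [[i' j'] [/= A' /andP[/= h1 h2] ne]] : exists y,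
    [/\ 0 < A y.1 y.2, point_le y (i, j) & y <> (i, j)].
  apply: contraNP h => h; apply/leading_pointP; split=> // y y0 yij.
  by apply: contrapT => ne; apply: h; exists y.
have lt : (i' + j' < i + j)%N.
  have : (i' != i) || (j' != j).
    by rewrite -negb_and; apply/negP => /andP[/eqP E1 /eqP E2]; apply: ne; rewrite E1 E2.
  by rewrite -!val_eqE /=; lia.
have [x xL /andP[x1 x2]] := IH i' j' ltac:(lia) A'.
by exists x => //; rewrite (leq_trans x1 h1) (leq_trans x2 h2).
Qed.

Lemma leading_points_sorted A : sorted precedes (leading_points A).
Proof.
have U : uniq (leading_points A) by rewrite sort_uniq enum_uniq.
have : sorted (fun x y => (x.2 <= y.2)%N) (leading_points A).
  by apply: sort_sorted => x y; apply: leq_total.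
move=> S; have : all (mem (leading_points A)) (leading_points A) by apply/allP.
move: S U; elim: {-3}(leading_points A) => [|x [|y L] IH] //=.
move=> /andP[xy S] /andP[xL U] /and3P[x1 y1 h].
apply/andP; split; last by apply: IH => //=; rewrite y1.
have ne : x <> y by move=> E; rewrite E inE eqxx in xL.
have /leading_pointP[xA hx] := x1; have /leading_pointP[yA hy] := y1.
have yx1 : (y.1 < x.1)%N.
  by rewrite ltnNge; apply/negP => h1; apply: ne; apply: hy => //; apply/andP.
rewrite /precedes yx1 andbT ltn_neqAle xy andbT; apply/eqP => E; apply: ne.
by apply/esym; apply: hx => //; rewrite /point_le (ltnW yx1) E leqnn.
Qed.

Lemma leading_points_neq0 A : (forall i j, 0 <= A i j) -> A != 0 ->
  leading_points A != [::].
Proof.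
move=> A0; apply: contraNneq => E; apply/eqP/matrixP => i j; rewrite mxE.
apply/eqP; rewrite eq_le A0 andbT leNgt; apply/negP => /leading_point_le[x].
by rewrite E.
Qed.

(** Row indices decrease along the list of leading points, so this is the leftmost one among the
    rows before [i]. Its column is the letter [c] of the segment present when row [i] is about to be
    inserted; [None] means that no leading point has been met. *)
Definition first_above L (i : nat) := ohead [seq x : 'I_m * 'I_n <- L | (x.1 < i)%N].

Lemma first_above_none L i x : first_above L i = None -> x \in L -> (i <= x.1)%N.
Proof.
rewrite /first_above; case E: filter => // _ xL; rewrite leqNgt; apply/negP => xi.
by have : x \in [seq x : 'I_m * 'I_n <- L | (x.1 < i)%N]; [rewrite mem_filter xi|rewrite E].
Qed.

Lemma first_above_some L i y : sorted precedes L -> first_above L i = Some y ->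
  [/\ y \in L, (y.1 < i)%N
    & forall z, z \in L -> (z.1 < i)%N -> (y.2 <= z.2)%N].
Proof.
elim: L => [|x L IH] //= sL; rewrite /first_above /=; case: ifP => [xi [<-]|xi h].
  rewrite inE eqxx; split=> // z; rewrite inE => /orP[/eqP->//|zL] _.
  by have /allP/(_ _ zL)/andP[/ltnW] := order_path_min precedes_trans sL.
have [yL yi yz] := IH (path_sorted sL) h; rewrite inE yL orbT; split=> // z.
by rewrite inE => /orP[/eqP->|/yz//]; rewrite xi.
Qed.

Lemma first_above_skip L (i : 'I_m) : ~~ has (fun x => x.1 == i) L ->
  first_above L i.+1 = first_above L i.
Proof.
move=> /hasPn h; congr ohead; apply: eq_in_filter => x /h xi.
by move: xi; rewrite -val_eqE /= ltnS leq_eqVlt => /negPf->.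
Qed.

Lemma first_above_at L x : sorted precedes L -> x \in L ->
  first_above L x.1.+1 = Some x.
Proof.
elim: L => [|y L IH] //= sL; rewrite inE /first_above /=.
case/orP=> [/eqP->|xL]; first by rewrite leqnn.
have /allP/(_ _ xL)/andP[_ xy] := order_path_min precedes_trans sL.
by rewrite ltnS leqNgt xy /=; apply: IH => //; apply: path_sorted sL.
Qed.

Lemma first_above_all x L : first_above (x :: L) m = Some x.
Proof. by rewrite /first_above /= ltn_ord. Qed.

Lemma sum_delta d L i j : uniq L ->
  (\sum_(x <- L) d *: delta_mx x.1 x.2 : 'M_(m, n)) i j = d *+ ((i, j) \in L).
Proof.
elim: L => [|x L IH] /=; first by rewrite big_nil mxE mulr0n.
move=> /andP[xL uL]; rewrite big_cons !mxE IH // inE.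
have -> : ((i, j) == x) = (i == x.1) && (j == x.2) by case: x {xL}.
have [E|_] := boolP (_ && _); last by rewrite mulr0 add0r.
have -> : ((i, j) \in L) = false.
  by move: E xL => /andP[/eqP-> /eqP->]; case: x => ? ? /negPf.
by rewrite mulr1 addr0.
Qed.

(** The leading point of row [i] and its successor in the list, which is [first_above L i], meet in
    row [i] at the column of the successor: the letter bumped by the insertion of row [i]. The last
    point of the list has no successor and contributes nothing. *)
Lemma shadow_row d L (i : 'I_m) j : sorted precedes L ->
  (\sum_(x <- shadow_points L) d *: delta_mx x.1 x.2 : 'M_(m, n)) i j =
  if has (fun x => x.1 == i) L then
    if first_above L i is Some y then d *+ (j == y.2) else 0
  else 0.
Proof.
elim: L => [|x [|y L] IH] sL; rewrite /shadow_points /=.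
- by rewrite big_nil mxE.
- rewrite big_nil mxE orbF /first_above /=; case: eqP => // ->.
  by rewrite ltnn.
have /= /andP[/andP[xy2 xy1] sL'] := sL.
have := IH sL'; rewrite /shadow_points /= big_cons !mxE => -> /=.
rewrite [i == _]eq_sym; case: eqVneq => [xi|xi] /=.
  have h z : z \in y :: L -> (z.1 < i)%N.
    move=> zL; have /allP/(_ _ zL)/andP[_] := order_path_min precedes_trans sL.
    by rewrite xi.
  have /= -> : has (fun z => z.1 == i) (y :: L) = false.
    by apply/negbTE/hasPn => z /h; rewrite -val_eqE neq_ltn => ->.
  by rewrite addr0 /first_above /= xi ltnn h ?inE ?eqxx // mulr_natr.
rewrite mulr0 add0r; case: ifP => // h.
suff : ~~ (x.1 < i)%N by rewrite /first_above /= => /negPf->.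
have /hasP[z zL /eqP zi] : has (fun z => z.1 == i) (y :: L) by [].
have /allP/(_ _ zL)/andP[_] := order_path_min precedes_trans sL.
by rewrite zi -leqNgt => /ltnW.
Qed.

End LeadingPoints.

(** * The first row of the tableau and the runs of the two loops *)

Section FirstRow.
Variables (R : realType) (m n : nat).
Implicit Types (A S : 'M[R]_(m, n)) (x y z : 'I_m * 'I_n).
Implicit Types (L : seq ('I_m * 'I_n)) (d : R) (W : nat -> timed_word R n).

Definition row_word A i : timed_word R n := content_word (A i).

(** [W i] is the first row of the tableau just before row [i] is inserted, and row [i] of [S]
    records what this insertion bumps. The last two clauses locate letters in earlier rows of [A]:
    this bounds them from below by the column of [first_above], and it pushes the support of [S]
    downwards. *)
Definition first_row A S W : Prop :=
  [/\ W 0%N = tempty, forall i, is_row (W i),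
      forall i : 'I_m, rins (W i) (row_word A i) = (row_word S i, W i.+1),
      forall i e, letter e (W i) -> exists2 k : 'I_m, (k < i)%N & 0 < A k e
    & forall i j, 0 <= S i j /\
        (0 < S i j -> exists2 k : 'I_m, (k < i)%N & 0 < A k j)].

Lemma first_above_le A (i : nat) y (k : 'I_m) e :
  first_above (leading_points A) i = Some y -> (k < i)%N -> 0 < A k e -> (y.2 <= e)%N.
Proof.
move=> /(first_above_some (leading_points_sorted A))[_ _ h] ki /leading_point_le.
move=> [x xL /andP[x1 x2]]; apply: leq_trans x2.
by apply: h => //; apply: leq_ltn_trans ki.
Qed.

Lemma first_above_none_eq0 A (i : nat) (k : 'I_m) e :
  first_above (leading_points A) i = None -> (k < i)%N -> 0 < A k e -> False.
Proof.
move=> h ki /leading_point_le[x /(first_above_none h) ix /andP[xk _]].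
by have := leq_ltn_trans (leq_trans ix xk) ki; rewrite ltnn.
Qed.

(* Removing one layer of thickness [d] from the leading points removes the
   initial segment of length [d] from the first row at every stage: inserting
   the row of a leading point bumps that segment as a whole, and inserting any
   other row leaves it in place. *)
Lemma first_row_step A S W d : let L := leading_points A in
  (forall i j, 0 <= A i j) -> 0 < d ->
  (forall x, x \in L -> d <= A x.1 x.2) ->
  first_row (A - \sum_(x <- L) d *: delta_mx x.1 x.2) S W ->
  first_row A (S + \sum_(x <- shadow_points L) d *: delta_mx x.1 x.2)
    (fun i => (if first_above L i is Some y then tpow y.2 d else tempty) :+: W i).
Proof.
move=> L A0 d0 dL; set A' := A - _; set S' := S + _.
case=> [W0 rW hW lW hS].
have sL : sorted (@precedes m n) L := leading_points_sorted A.
have uL : uniq L by rewrite sort_uniq enum_uniq.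
have A'E i j : A' i j = A i j - d *+ ((i, j) \in L) by rewrite !mxE sum_delta.
have sub i j : 0 < A' i j -> 0 < A i j.
  rewrite A'E; case: (_ \in _); rewrite ?subr0 // subr_gt0; exact: lt_trans.
have lead x : x \in L -> 0 < A x.1 x.2 by case/leading_pointP.
have WA i e : letter e (W i) -> exists2 k : 'I_m, (k < i)%N & 0 < A k e.
  by case/lW => k ki /sub; exists k.
have SA i j : 0 < S i j -> exists2 k : 'I_m, (k < i)%N & 0 < A k j.
  by case/(proj2 (hS i j)) => k ki /sub; exists k.
have S'E i j : S' i j = S i j +
    (if has (fun x => x.1 == i) L then
       if first_above L i is Some y then d *+ (j == y.2) else 0
     else 0) by rewrite mxE shadow_row.
split.
- by rewrite W0 tcatw0; case E: first_above => [y|] //; have [] := first_above_some sL E.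
- move=> i; case E: first_above => [y|]; rewrite ?tcat0w //.
  apply/is_row_tcat; split=> //; first exact: is_row_tpow.
  by move=> c e /letter_tpow[-> _] /WA[k ki]; apply: first_above_le E ki.
- move=> i; rewrite /row_word.
  have row_pre : is_row ((if first_above L i is Some y then tpow y.2 d else tempty) :+: W i).
    case E: first_above => [y|]; rewrite ?tcat0w //.
    apply/is_row_tcat; split=> //; first exact: is_row_tpow.
    by move=> c e /letter_tpow[-> _] /WA[k ki]; apply: first_above_le E ki.
  have [/hasP[x xL /eqP xi]|noi] := boolP (has (fun x => x.1 == i) L); last first.
    rewrite first_above_skip //.
    have -> : A i = A' i.
      apply/funext => j; rewrite A'E; have [ijL|_] := boolP (_ \in _); rewrite ?subr0 //.
      by case/negP: noi; apply/hasP; exists (i, j) => /=.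
    have -> : S' i = S i.
      by apply/funext => j; rewrite S'E (negPf noi) addr0.
    rewrite rins_shift ?hW //; first exact: content_word_row.
    move=> c e; case E: first_above => [y|]; last by move/letter_tempty.
    (* Row [i] has no leading point, so [y] is also the leftmost one among the rows up to and
       including [i], and its column bounds the letters being inserted. *)
    move=> /letter_tpow[-> _] /letter_content/sub; rewrite -first_above_skip // in E.
    by apply: first_above_le E _.
  have Ei : first_above L i.+1 = Some x by rewrite -xi; apply: first_above_at.
  have xle (k : 'I_m) e : (k <= i)%N -> 0 < A k e -> (x.2 <= e)%N.
    by move=> ki; apply: first_above_le Ei _.
  (* By [xle] no entry of row [i] lies left of column [x.2], so the removed layer is the initial
     segment of the inserted row. *)
  have -> : content_word (A i) = tpow x.2 d :+: content_word (A' i).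
    rewrite tpow_content_word ?(ltW d0) //.
    - congr content_word; apply/funext => j; rewrite A'E.
      have -> : ((i, j) \in L) = (j == x.2).
        apply/idP/eqP => [ijL|->]; last by rewrite -xi -surjective_pairing.
        by have := first_above_at sL ijL; rewrite Ei => -[->].
      by rewrite addrC subrK.
    - move=> j; rewrite A'E; have [/dL|_] := boolP (_ \in _); rewrite ?subr0 ?subr_ge0 //.
    - by move=> e /sub; apply: xle.
  rewrite Ei rins_tcat //; [|exact: is_row_tpow|exact: content_word_row].
  have -> : rins ((if first_above L i is Some y then tpow y.2 d else tempty) :+: W i)
      (tpow x.2 d) =
      (if first_above L i is Some y then tpow y.2 d else tempty, tpow x.2 d :+: W i).
    (* Without a leading point in the earlier rows these rows vanish, hence [W i] is empty and
       nothing is bumped. *)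
    case E: first_above row_pre => [y|] row_pre; last first.
      have -> : W i = tempty.
        by apply: no_letter_tempty => e /WA[k]; apply: first_above_none_eq0 E.
      by rewrite tcat0w rins_append tcat0w ?tcatw0 //; apply: is_row_tpow.
    have [yL yi _] := first_above_some sL E.
    (* Otherwise [y], which lies in an earlier row, would be below [x], against the minimality of
       [x]. *)
    have xy : (x.2 < y.2)%N.
      rewrite ltnNge; apply/negP => yx; have /leading_pointP[_ hx] := xL.
      have yE : y = x by apply: hx; [apply: lead|rewrite /point_le yx xi ltnW].
      by rewrite yE xi ltnn in yi.
    have {2 4}-> : d = tlen (tpow y.2 d) by rewrite tlen_tpow // ltW.
    rewrite rins_bump // => e /letter_tcat[/letter_tpow[-> //]|].
    by move=> /WA[k ki /(first_above_le E ki)]; apply: leq_trans.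
  rewrite /= rins_shift ?hW //=; last first.
  + by move=> c e /letter_tpow[-> _] /letter_content/sub; apply: xle.
  + exact: content_word_row.
  + apply/is_row_tcat; split=> //; first exact: is_row_tpow.
    by move=> c e /letter_tpow[-> _] /WA[k /ltnW]; apply: xle.
  congr (_, _); have hasx : has (fun x => x.1 == i) L.
    by apply/hasP; exists x => //; apply/eqP.
  have S'i : S' i = fun j => S i j +
      (if first_above L i is Some y then d *+ (j == y.2) else 0).
    by apply/funext => j; rewrite S'E hasx.
  rewrite S'i; case E: first_above => [y|].
    rewrite tpow_content_word ?(ltW d0) //.
    - by congr content_word; apply/funext => j; rewrite addrC.
    - by move=> j; case: (hS i j).
    - by move=> e /SA[k]; apply: first_above_le E.
  by rewrite tcat0w; congr content_word; apply/funext => j; rewrite addr0.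
- move=> i e /letter_tcat[|/WA//].
  case E: first_above => [y|]; last by move/letter_tempty.
  have [/lead yA yi _] := first_above_some sL E.
  by move=> /letter_tpow[-> _]; exists y.1.
- move=> i j; have [Sij hSij] := hS i j; rewrite S'E; case: ifP => _; last first.
    by rewrite addr0; split=> // /SA.
  case E: first_above => [y|]; last by rewrite addr0; split=> // /SA.
  have [/lead yA yi _] := first_above_some sL E.
  case: eqP => [jy|_]; last by rewrite addr0; split=> // /SA.
  by split=> [|_]; [exact: addr_ge0 Sij (ltW d0)|exists y.1; rewrite ?jy].
Qed.

Lemma first_row0 : first_row 0 0 (fun=> tempty).
Proof.
have r0 : forall i : 'I_m, row_word 0 i = tempty.
  by move=> i; apply: content_word0 => j; rewrite mxE.
split=> // [i|i e /letter_tempty//|i j]; first by rewrite !r0 rins_tempty.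
by rewrite !mxE ltxx; split.
Qed.

Lemma bigmin_spec (x : 'I_m * 'I_n) L A :
  let d := \big[Num.min/A x.1 x.2]_(y <- L) A y.1 y.2 in
  (exists2 y, y \in x :: L & d = A y.1 y.2) /\
  forall y, y \in x :: L -> d <= A y.1 y.2.
Proof.
elim: L => [|y L [[z zL zE] h]] /=.
  rewrite big_nil; split; first by exists x; rewrite ?inE.
  by move=> y; rewrite inE => /eqP->.
rewrite big_cons; set d := \big[_/_]_(_ <- L) _ in zE h *; split.
  have [] := leP (A y.1 y.2) d => _; first by exists y; rewrite ?inE ?eqxx ?orbT.
  by exists z => //; move: zL; rewrite !inE => /orP[->|->]; rewrite ?orbT.
move=> w; rewrite !inE orbCA -in_cons => /orP[/eqP->|/h]; rewrite ge_min ?lexx //.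
by move=> ->; rewrite orbT.
Qed.

Lemma inner_bodyE A S (p : timed_word R n) (q : timed_word R m) :
  (forall i j, 0 <= A i j) -> A != 0 ->
  exists x L d,
  [/\ leading_points A = x :: L, 0 < d,
      forall y, y \in leading_points A -> d <= A y.1 y.2,
      exists2 y, y \in leading_points A & d = A y.1 y.2
    & inner_body (A, S, p, q) =
      (A - \sum_(y <- leading_points A) d *: delta_mx y.1 y.2,
       S + \sum_(y <- shadow_points (leading_points A)) d *: delta_mx y.1 y.2,
       p :+: tpow x.2 d, q :+: tpow (last x L).1 d)].
Proof.
move=> A0 /(leading_points_neq0 A0); rewrite /inner_body.
case E: (leading_points A) => [|x L] // _.
have [[y yL dE] h] := bigmin_spec x L A.
exists x, L, (\big[Num.min/A x.1 x.2]_(y <- L) A y.1 y.2); split=> //.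
  by rewrite dE; have /leading_pointP[] : y \in leading_points A by rewrite E.
by exists y.
Qed.

Lemma inner_body_ge0 A d : (forall i j, 0 <= A i j) ->
  (forall y, y \in leading_points A -> d <= A y.1 y.2) -> forall i j,
  0 <= (A - \sum_(y <- leading_points A) d *: delta_mx y.1 y.2 : 'M_(m, n)) i j.
Proof.
move=> A0 dA i j; have uL : uniq (leading_points A) by rewrite sort_uniq enum_uniq.
rewrite !mxE sum_delta //; have [/dA|_] := boolP (_ \in _); by rewrite ?subr0 ?subr_ge0.
Qed.

(** The induction hypothesis concerns the rest of the run, started on the thinned matrix;
    [first_row_step] adds the round just made. The accumulators [B] and [p] are arbitrary so that it
    applies in the middle of a run. *)
Lemma inner_loop_first_row st st' : inner_loop st st' ->
  forall A B p q, st = (A, B, p, q) -> (forall i j, 0 <= A i j) ->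
  exists A' q' S W, first_row A S W /\ st' = (A', B + S, p :+: W m, q').
Proof.
elim=> {st st'} [st + A B p q E A0|st st1 st2 + -> _ IH A B p q E A0].
  rewrite E negbK => /eqP->; exists 0, q, 0, (fun=> tempty).
  by rewrite addr0 tcatw0; split=> //; apply: first_row0.
rewrite {}E in IH *; rewrite /= => An0.
have [x [L [d [LE d0 dA _ bE]]]] := inner_bodyE B p q A0 An0.
have [A' [q' [S [W [h ->]]]]] := IH _ _ _ _ bE (inner_body_ge0 A0 dA).
exists A', q'; do 2 eexists; split; first exact: first_row_step A0 d0 dA h.
(* At stage [m] the prepended segment belongs to the head [x] of the list, so it is the letter power
   that the round appends to [p]. *)
by rewrite LE first_above_all -addrA [_ + S]addrC tcatA.
Qed.

(** Each round annihilates the entry attaining the minimum [d] and creates no new one, so the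
    support shrinks. *)
Lemma inner_loop_ex A B (p : timed_word R n) (q : timed_word R m) :
  (forall i j, 0 <= A i j) -> exists st, inner_loop (A, B, p, q) st.
Proof.
move: {2}#|_| (leqnn #|Defs.support A|) => k.
elim: k A B p q => [|k IH] A B p q hk A0.
  exists (A, B, p, q); apply: While_stop; rewrite negbK.
  apply/eqP/matrixP => i j; rewrite mxE; apply/eqP; rewrite eq_le A0 andbT leNgt.
  apply/negP => Aij; move: hk; rewrite leqn0 cards_eq0 => /eqP/setP/(_ (i, j)).
  by rewrite !inE Aij.
have [An0|An0] := eqVneq A 0.
  by exists (A, B, p, q); apply: While_stop; rewrite An0 negbK.
have [x [L [d [LE d0 dA [y yL dE] bE]]]] := inner_bodyE B p q A0 An0.
have uL : uniq (leading_points A) by rewrite sort_uniq enum_uniq.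
set A' := A - _ in bE.
suff hk' : (#|Defs.support A'| <= k)%N.
  have [st hst] := IH A'
    (B + \sum_(z <- shadow_points (leading_points A)) d *: delta_mx z.1 z.2)
    (p :+: tpow x.2 d) (q :+: tpow (last x L).1 d) hk' (inner_body_ge0 A0 dA).
  by exists st; apply: While_step hst.
rewrite -ltnS; apply: leq_trans hk; apply: proper_card; apply/properP; split.
  apply/fintype.subsetP => z; rewrite !inE /A' !mxE sum_delta //.
  by case: (_ \in _); rewrite ?subr0 // subr_gt0; apply: lt_trans.
exists y; rewrite !inE; first by case/leading_pointP: yL.
by rewrite /A' !mxE sum_delta // -surjective_pairing yL dE subrr ltxx.
Qed.

Definition tableau_word A : timed_word R n :=
  wcat (rev (foldl (@insert_seq R n) [::] [seq row_word A i | i <- enum 'I_m])).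

Lemma tableau_wordE A : tableau_word A = tableauP (uword A).
Proof.
rewrite /tableau_word -tableauP_rows; last first.
  by apply/allP => u /mapP[i _ ->]; apply/asboolP/content_word_row.
by rewrite /wcat big_map enumT /uword [index_enum _]unlock.
Qed.

Lemma first_row_tableau A S W : first_row A S W ->
  tableau_word A = tableau_word S :+: W m.
Proof. by case=> *; apply: wcat_first_row => // i; apply: content_word_row. Qed.

Lemma outer_loop_tableau st st' : outer_loop st st' ->
  forall A P Q, st = (A, P, Q) -> (forall i j, 0 <= A i j) ->
  st'.1.2 = tableau_word A :+: P.
Proof.
elim=> {st st'} [st + A P Q E A0|st st1 st2 + + _ IH A P Q E A0]; rewrite E.
  rewrite negbK => /eqP->; rewrite /tableau_word /=.
  suff -> : forall s : seq 'I_m, foldl (@insert_seq R n) [::]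
      [seq row_word (0 : 'M[R]_(m, n)) i | i <- s] = [::].
    by rewrite /wcat big_nil tcat0w.
  elim=> //= i s IHs; rewrite ifT //; apply/eqP; apply: content_word0 => j.
  by rewrite mxE.
move=> _ [A' [B [p [q [/inner_loop_first_row h st1E]]]]].
have [A'' [q' [S [W [fr [_ SE pE _]]]]]] := h _ _ _ _ erefl A0.
rewrite (IH _ _ _ st1E) => [|i j].
  by rewrite (first_row_tableau fr) SE pE add0r tcat0w tcatA.
by rewrite SE add0r; case: fr => _ _ _ _ /(_ i j)[].
Qed.

(** Every positive entry of the shadow matrix has a positive entry of [A] in an earlier row, so the
    first rows of the support move down by at least one per round; [k] counts the last rows in which
    the support may still lie. *)
Lemma outer_loop_ex A P Q : (forall i j, 0 <= A i j) ->
  exists st, outer_loop (A, P, Q) st.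
Proof.
have [k hk] : exists k, forall i j, 0 < A i j -> (m <= i + k)%N.
  by exists m => *; apply: leq_addl.
elim: k A P Q hk => [|k IH] A P Q hk A0.
  exists (A, P, Q); apply: While_stop; rewrite negbK; apply/eqP/matrixP => i j.
  rewrite mxE; apply/eqP; rewrite eq_le A0 andbT leNgt; apply/negP => /hk.
  by rewrite addn0 leqNgt ltn_ord.
have [An0|An0] := eqVneq A 0.
  by exists (A, P, Q); apply: While_stop; rewrite An0 negbK.
have [st hst] := inner_loop_ex 0 tempty tempty A0.
have [A' [q' [S [W [fr stE]]]]] := inner_loop_first_row hst erefl A0.
rewrite stE add0r tcat0w in hst.
have [_ _ _ _ hS] := fr.
have [|i j|st' hst'] := IH S (W m :+: P) (q' :+: Q).
- move=> i j /(proj2 (hS i j))[k' ki /hk]; rewrite addnS => h; apply: leq_trans h _.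
  by rewrite -addSn leq_add2r.
- by case: (hS i j).
exists st'; apply: While_step hst' => //.
by exists A', S, (W m), q'.
Qed.

End FirstRow.

(** * Symmetry of the algorithm under transposition *)

Section Transposition.
Variables (R : realType).

Definition swap (m n : nat) (x : 'I_m * 'I_n) := (x.2, x.1).

(** Both lists have the same members and are sorted for the strict order [precedes]; swapping
    coordinates reverses that order. *)
Lemma leading_points_tr m n (A : 'M[R]_(m, n)) :
  leading_points A^T = rev (map (@swap m n) (leading_points A)).
Proof.
have irr : irreflexive (@precedes n m) by move=> x; rewrite /precedes ltnn.
apply: (irr_sorted_eq (@precedes_trans n m) irr).
- exact: leading_points_sorted.
- rewrite rev_sorted sorted_map; apply: sub_sorted (leading_points_sorted A) => x y.
  by rewrite /precedes /= andbC.
move=> [j i]; rewrite mem_rev -[(j, i)]/(swap (i, j)) mem_map; last first.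
  by move=> [? ?] [? ?] [-> ->].
apply/leading_pointP/leading_pointP; rewrite /= mxE => -[h1 h2]; split=> //.
  move=> [i' j'] /= h3 h4; have := h2 (j', i'); rewrite /= mxE => h.
  have [-> -> //] : (j', i') = (j, i) by apply: h => //; rewrite /point_le andbC.
move=> [j' i'] /=; rewrite mxE => h3 h4; have := h2 (i', j') => /= h.
by have [-> ->] : (i', j') = (i, j) by apply: h => //; rewrite /point_le andbC.
Qed.

Lemma shadow_points_rcons m n L (y x : 'I_m * 'I_n) :
  shadow_points (rcons (rcons L y) x) =
  rcons (shadow_points (rcons L y)) (y.1, x.2).
Proof.
elim: L => [|z L IH] //; case: L IH => [|w L] //.
by rewrite !rcons_cons /shadow_points /= => ->.
Qed.

(** Consecutive points [x], [y] turn into [swap y], [swap x], whose corner is [(y.2, x.1)], the swap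
    of the original corner [(x.1, y.2)]. *)
Lemma shadow_points_tr m n (L : seq ('I_m * 'I_n)) :
  shadow_points (rev (map (@swap m n) L)) = rev (map (@swap m n) (shadow_points L)).
Proof.
elim: L => [|x [|y L] IH] //.
by rewrite !map_cons !rev_cons shadow_points_rcons -rev_cons -map_cons IH.
Qed.

Lemma sum_delta_tr m n (L : seq ('I_m * 'I_n)) (d : R) :
  \sum_(y <- rev (map (@swap m n) L)) d *: delta_mx y.1 y.2 =
  (\sum_(y <- L) d *: delta_mx y.1 y.2)^T :> 'M_(n, m).
Proof.
rewrite (perm_big _ (permEl (perm_rev _))) big_map linear_sum.
by apply: eq_bigr => y _; rewrite linearZ /= trmx_delta.
Qed.

Definition inner_tr m n (st : inner_state R m n) : inner_state R n m :=
  let: (A, B, p, q) := st in (A^T, B^T, q, p).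

Lemma inner_body_tr m n (st : inner_state R m n) :
  inner_body (inner_tr st) = inner_tr (inner_body st).
Proof.
case: st => [[[A B] p] q]; rewrite /inner_body /= leading_points_tr.
case E: (leading_points A) => [|x L] //.
case E': (rev _) => [|x' L'].
  by have := congr1 size E'; rewrite size_rev.
(* Reversal exchanges the head and the last point, and hence the letters appended to [p] and [q]. *)
have xl : x' = swap (last x L).
  have -> : x' = head x' (rev [seq swap i | i <- x :: L]) by rewrite E'.
  by rewrite lastI map_rcons rev_rcons.
have lx : last x' L' = swap x.
  have -> : last x' L' = last x' (rev [seq swap i | i <- x :: L]) by rewrite E'.
  by rewrite map_cons rev_cons last_rcons.
set d' := \big[_/_]_(_ <- L') _; set d := \big[_/_]_(_ <- L) _.
(* The two minima start from different points of the list, so they are compared through the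
   characterisation in [bigmin_spec]. *)
have dd : d' = d.
  have [[y yL dE] h] := bigmin_spec x L A; rewrite -/d in dE h.
  have [[y' yL' dE'] h'] := bigmin_spec x' L' A^T; rewrite -/d' in dE' h'.
  apply/le_anti/andP; split.
    rewrite dE; have := h' (swap y); rewrite /= mxE; apply.
    by rewrite -E' mem_rev map_f.
  rewrite dE' mxE; move: yL'; rewrite -E' mem_rev => /mapP[z zL ->].
  exact: h.
rewrite dd lx -E' sum_delta_tr shadow_points_tr sum_delta_tr xl /=.
by rewrite linearB linearD.
Qed.

Lemma trmx_neq0 m n (A : 'M[R]_(m, n)) : (A^T != 0) = (A != 0).
Proof. by rewrite -(inj_eq (@trmx_inj _ _ _)) trmxK trmx0. Qed.

Lemma inner_loop_tr m n (st st' : inner_state R m n) :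
  inner_loop st st' -> inner_loop (inner_tr st) (inner_tr st').
Proof.
elim=> {st st'} [[[[A B] p] q] g|[[[A B] p] q] st1 st2 g -> _ IH].
  by apply: While_stop; rewrite /= trmx_neq0.
apply: While_step IH; first by rewrite /= trmx_neq0.
by rewrite inner_body_tr.
Qed.

Definition outer_tr m n (st : outer_state R m n) : outer_state R n m :=
  let: (A, P, Q) := st in (A^T, Q, P).

Lemma outer_loop_tr m n (st st' : outer_state R m n) :
  outer_loop st st' -> outer_loop (outer_tr st) (outer_tr st').
Proof.
elim=> {st st'} [[[A P] Q] g|[[A P] Q] st1 st2 g b _ IH].
  by apply: While_stop; rewrite /= trmx_neq0.
apply: While_step IH; first by rewrite /= trmx_neq0.
case: b => A' [B [p [q [/inner_loop_tr /= h ->]]]].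
by exists A'^T, B^T, q, p; rewrite trmx0 in h.
Qed.

End Transposition.

Theorem theorem5p8 (R : realType) (m n : nat) (m_gt0 : (0 < m)%N)
    (n_gt0 : (0 < n)%N) (A : 'M[R]_(m, n)) (A_ge0 : forall i j, 0 <= A i j) :
  (exists PQ, light_and_shadows A PQ) /\
  (forall PQ, light_and_shadows A PQ -> PQ = RSK A).
Proof.
split.
  by have [[[A' P] Q] h] := outer_loop_ex tempty tempty A_ge0; exists (P, Q), A'.
move=> [P Q] [A' /= h]; rewrite /RSK; congr pair.
  by have /= -> := outer_loop_tableau h erefl A_ge0; rewrite tcatw0 tableau_wordE.
have AT_ge0 i j : 0 <= A^T i j by rewrite mxE.
(* In the transposed run [Q] takes the place of [P], and [uword A^T] is [vword A] factor by
   factor. *)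
have /= -> := outer_loop_tableau (outer_loop_tr h) erefl AT_ge0.
rewrite tcatw0 tableau_wordE; congr tableauP; apply: eq_bigr => j _.
by apply: eq_bigr => i _; rewrite mxE.
Qed.
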